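(* Let $\ell\ge1$ and let $\alpha=(\alpha_1,\dots,\alpha_k)$ be a composition of $\ell$ with $k\ge1$ parts. Then $OSym_\alpha$ is a free right $OSym_\ell$-supermodule with basis $\{p^{(\ell)}_w: w\in[S_\ell/S_\alpha]_{\min}\}$, and each $p^{(\ell)}_w$ in this basis lies in $OSym_\alpha\cap OPol_{\ell-\alpha_k}$.
   Context: $\Bbbk$ is a field of characteristic $\neq2$. $OPol_\ell$: graded superalgebra generated by odd degree-2 $x_1,\dots,x_\ell$ with $x_jx_i=-x_ix_j$ ($i\ne j$); $OPol_M$ ($M\le\ell$) is the subalgebra generated by $x_1,\dots,x_M$. $OSym_\ell\subseteq OPol_\ell$ is the subalgebra generated by $e^{(\ell)}_r:=\sum_{1\le i_1<\cdots<i_r\le\ell}x_{i_1}\cdots x_{i_r}$. $\partial_j$ ($1\le j<\ell$) is the odd Demazure operator: the unique odd linear map with $\partial_j(x_i)=\delta_{i,j}-\delta_{i,j+1}$ and $\partial_j(fg)=\partial_j(f)g+({}^{s_j}f)\partial_j(g)$, where ${}^{s_j}$ is the superalgebra automorphism $x_j\mapsto x_{j+1}$, $x_{j+1}\mapsto x_j$, $x_i\mapsto -x_i$ otherwise. $OSym_\alpha:=\bigcap\ker\partial_i$ over $i\in\{1,\dots,\ell-1\}\setminus\{\alpha_1,\alpha_1+\alpha_2,\dots\}$. $S_\alpha\le S_\ell$ is the parabolic subgroup generated by $s_i$ for $i$ not a partial sum of $\alpha$, and $[S_\ell/S_\alpha]_{\min}$ the set of minimal-length left coset representatives. Let $w_\ell$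 be the longest element of $S_\ell$ and $\xi_\ell:=x_{\ell-1}x_{\ell-2}^2\cdots x_1^{\ell-1}$. For $w\in S_\ell$ choose a reduced expression $w=s_{j_1}\cdots s_{j_l}$ and set $\partial_w:=\partial_{j_1}\circ\cdots\circ\partial_{j_l}$ (well defined up to sign). The odd Schubert polynomial is $p^{(\ell)}_w:=\partial_{w^{-1}w_\ell}(\xi_\ell)$ (defined up to a sign depending on the reduced expression; the statement holds for any choices). *)

(* Defs.v *)
(* the odd polynomial superalgebra is modelled on the vector
   space {mpoly K[l]} (ordered monomials x_0^{a_0} ... x_(l-1)^{a_(l-1)} as basis)
   with a new (skew) multiplication [omul].  Variables are 0-indexed:
   paper's x_i  = our [X (i-1)],  paper's d_j = our [dem (j-1)]. *)
From HB Require Import structures.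
From mathcomp Require Import all_boot all_order all_algebra all_fingroup.
From mathcomp Require Import mpoly.
Set Implicit Arguments. Unset Strict Implicit. Unset Printing Implicit Defensive.
Import GRing.Theory.
Local Open Scope ring_scope.

Section OddPol.
Variables (K : fieldType) (l : nat).

Notation P := {mpoly K[l]}.

Definition X (i : 'I_l) : P := 'X_i.

(* product of ordered monomials:
   x^a x^b = (-1)^(sum_{i>j} a_i b_j) x^(a+b)  (from x_j x_i = - x_i x_j, i<>j) *)
Definition omon (a b : 'X_{1..l}) : P :=
  (-1) ^+ (\sum_(i < l) \sum_(j < l | (j < i)%N) (a i * b j))%N
    *: 'X_[mnm_add a b].

Definition omul (p q : P) : P :=
  \sum_(a <- msupp p) \sum_(b <- msupp q) (p@_a * q@_b) *: omon a b.

Definition opow (p : P) (n : nat) : P := iter n (omul p) 1.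

Definition prodw (w : seq 'I_l) : P := foldr (fun i q => omul (X i) q) 1 w.

Definition mword (a : 'X_{1..l}) : seq 'I_l :=
  flatten [seq nseq (a i) i | i <- enum 'I_l].

Definition sx (j : nat) (i : 'I_l) : P :=
  if (i == j :> nat) then \sum_(k < l | (k == j.+1 :> nat)) X k
  else if (i == j.+1 :> nat) then \sum_(k < l | (k == j :> nat)) X k
  else - X i.

Definition dx (j : nat) (i : 'I_l) : P :=
  ((i == j :> nat)%:R - (i == j.+1 :> nat)%:R) *: 1.

Definition sword (j : nat) (w : seq 'I_l) : P :=
  foldr (fun i q => omul (sx j i) q) 1 w.

(* d_j on a word, by the twisted Leibniz rule d(fg) = d(f) g + (s f) d(g)
   applied with f = first letter, g = rest of the word *)
Fixpoint dword (j : nat) (w : seq 'I_l) : P :=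
  match w with
  | [::] => 0
  | i :: w' => omul (dx j i) (prodw w') + omul (sx j i) (dword j w')
  end.

Definition osig (j : nat) (p : P) : P :=
  \sum_(a <- msupp p) p@_a *: sword j (mword a).
Definition dem (j : nat) (p : P) : P :=
  \sum_(a <- msupp p) p@_a *: dword j (mword a).

Inductive gen_sub (G : P -> Prop) : P -> Prop :=
  | gen_in p : G p -> gen_sub G p
  | gen_1 : gen_sub G 1
  | gen_add p q : gen_sub G p -> gen_sub G q -> gen_sub G (p + q)
  | gen_scale c p : gen_sub G p -> gen_sub G (c *: p)
  | gen_mul p q : gen_sub G p -> gen_sub G q -> gen_sub G (omul p q).

Definition OPol (M : nat) (p : P) : Prop :=
  gen_sub (fun q => exists i : 'I_l, (i < M)%N /\ q = X i) p.

Definition esym (r : nat) : P :=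
  \sum_(S : {set 'I_l} | #|S| == r) prodw (enum S).

Definition OSym (p : P) : Prop :=
  gen_sub (fun q => exists r : nat, q = esym r) p.

Definition psums (al : seq nat) : seq nat :=
  [seq (\sum_(j < k.+1) nth 0 al j)%N | k <- iota 0 (size al)].

(* OSym_alpha: intersection of ker d_i, i in {1..l-1} not a partial sum
   (paper index i = our index i-1) *)
Definition OSymA (al : seq nat) (p : P) : Prop :=
  forall i : nat, (i.+1 < l)%N -> i.+1 \notin psums al -> dem i p = 0.

(* parity: x_i odd, so x^a has parity mdeg a mod 2 *)
Definition homogeneous (p : P) : Prop :=
  exists b : bool, forall a, a \in msupp p -> odd (mdeg a) = b.

Definition xi : P :=
  foldr (fun i q => omul (opow (X i) (l.-1 - i)) q) 1 (rev (enum 'I_l)).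

Definition demw (w : seq nat) (p : P) : P := foldr dem p w.

End OddPol.

Section Sym.
Variable l : nat.

Definition sj (j : nat) : 'S_l :=
  match (insub j : option 'I_l), (insub j.+1 : option 'I_l) with
  | Some a, Some b => tperm a b
  | _, _ => 1%g
  end.

Definition wprod (w : seq nat) : 'S_l := (\prod_(j <- w) sj j)%g.

Definition plen (w : 'S_l) : nat :=
  #|[set p : 'I_l * 'I_l | (p.1 < p.2)%N && (w p.2 < w p.1)%N]|.

Definition reduced_word (w : 'S_l) (s : seq nat) : Prop :=
  all (fun j => j.+1 < l)%N s /\ wprod s = w /\ size s = plen w.

Definition wlong : 'S_l := perm (@rev_ord_inj l).

Definition Salpha (al : seq nat) : {set 'S_l} :=
  <<[set sj j | j : 'I_l & (j.+1 < l)%N && (j.+1 \notin psums al)]>>%g.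

Definition mincoset (al : seq nat) (w : 'S_l) : bool :=
  [forall u in Salpha al, (plen w <= plen (w * u)%g)%N].

End Sym.

Definition oschub (K : fieldType) (l : nat) (red : 'S_l -> seq nat)
  (w : 'S_l) : {mpoly K[l]} :=
  demw (red (w^-1 * wlong l)%g) (xi K l).

(* Main.v *)
Require Import Defs.
From HB Require Import structures.
From mathcomp Require Import all_boot all_order all_algebra all_fingroup.
From mathcomp Require Import ssrcomplements mpoly zify.
Set Implicit Arguments. Unset Strict Implicit. Unset Printing Implicit Defensive.
Import GRing.Theory.
Local Open Scope ring_scope.

(** The operators [dem j] satisfy [dem j \o dem j = 0] and the braid relations up to sign, so
    [demw s] depends, up to a scalar, only on the permutation when [s] is reduced, and vanishes
    when [s] is not.  Lowering exponents of [xi] one at a time gives [demw s xi <> 0] for a word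
    of maximal length, so that [demw (red v) p_w] is a nonzero scalar if [v = w] and is [0] if
    [v <> w] and [plen w <= plen v].  This triangularity, together with linearity of the [dem j]
    over the common kernel of all of them, shows that the [p_w] are a basis of [OPol] over that
    common kernel; the indices that are not minimal in their coset drop out for elements of
    [OSymA al] because [demw (red w)] then ends with some [dem j] that kills [OSymA al].

    The common kernel is [OSym]: solving the recursion for elementary symmetric polynomials for
    the one with fewer variables shows that [OPol] is spanned over [OSym] on the right by the
    monomials below the staircase; for [f] in the common kernel,
    [demw (red w0) (xi f) = demw (red w0) xi * f] is a nonzero multiple of [f], and expanding
    [xi f] in the staircase monomials puts it in [OSym], as [demw (red w0)] sends these monomials
    to scalars.

    Finally [p_w] is supported on exponents below the staircase, hence free of the last
    variable, and an element of the kernel of [dem j] that is free of [x_(j+1)] is free of [x_j]: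
    going down through the last block removes all of its variables. *)

Local Notation "p ** q" := (omul p q) (at level 40, left associativity).

(** * The skew product *)

Section LinearExtension.
Variables (K : fieldType) (l : nat).
Local Notation P := {mpoly K[l]}.
Implicit Types (c : K) (a b d : 'X_{1..l}) (p q r : P) (i k : 'I_l) (w : seq 'I_l).

(** Linear extension from ordered monomials, the common shape of [omul], [osig] and [dem]; their
    linearity all comes from that of [mext]. *)
Definition mext (F : 'X_{1..l} -> P) (p : P) : P :=
  \sum_(a <- msupp p) p@_a *: F a.

(** Summing over all monomials of bounded degree frees the index set from the support of [p], so
    that sums for different polynomials can be compared. *)
Lemma mextwE F n p : (msize p <= n)%N ->
  mext F p = \sum_(a : 'X_{1..l < n}) p@_a *: F a.
Proof.
move=> le_pn; pose I : subFinType _ := 'X_{1..l < n}.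
rewrite /mext (big_mksub I) ?msupp_uniq //=; last first.
  by move=> x /msize_mdeg_lt /leq_trans; apply.
by rewrite big_rmcond //= => a /memN_msupp_eq0 ->; rewrite scale0r.
Qed.

Lemma mext_is_linear F : linear (mext F).
Proof.
move=> c p q; pose n := maxn (msize (c *: p + q)) (maxn (msize p) (msize q)).
have [h1 h2 h3] : [/\ msize (c *: p + q) <= n, msize p <= n & msize q <= n]%N.
  by rewrite /n; split; lia.
rewrite !(@mextwE _ n) // scaler_sumr -big_split; apply: eq_bigr => a _.
by rewrite mcoeffD mcoeffZ scalerDl scalerA.
Qed.
HB.instance Definition _ F :=
  GRing.isLinear.Build K P P *:%R (mext F) (mext_is_linear F).

Lemma mextX F a : mext F 'X_[a] = F a.
Proof. by rewrite /mext msuppX big_seq1 mcoeffX eqxx scale1r. Qed.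

Lemma mono_ind (Q : P -> Prop) : Q 0 -> (forall p q, Q p -> Q q -> Q (p + q)) ->
  (forall c p, Q p -> Q (c *: p)) -> (forall a, Q 'X_[a]) -> forall p, Q p.
Proof.
move=> Q0 QD QZ QX p; rewrite [p]mpolyE.
by elim/big_ind: _ => // a _; apply/QZ/QX.
Qed.

Lemma omulE p q : p ** q = mext (fun a => mext (omon K a) q) p.
Proof.
rewrite /omul /mext; apply: eq_bigr => a _; rewrite scaler_sumr.
by apply: eq_bigr => b _; rewrite scalerA.
Qed.

Lemma omul_is_linear p : linear (omul p).
Proof.
move=> c q r; rewrite !omulE /mext scaler_sumr -big_split; apply: eq_bigr => a _.
by rewrite -!/(mext _ _) linearP scalerDr !scalerA mulrC.
Qed.
HB.instance Definition _ p :=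
  GRing.isLinear.Build K P P *:%R (omul p) (omul_is_linear p).

Definition omulr q p : P := p ** q.

Lemma omulr_is_linear q : linear (omulr q).
Proof. by move=> c p r; rewrite /omulr !omulE linearP. Qed.
HB.instance Definition _ q :=
  GRing.isLinear.Build K P P *:%R (omulr q) (omulr_is_linear q).

Lemma omul0l q : 0 ** q = 0. Proof. exact: (linear0 (omulr q)). Qed.
Lemma omul0r p : p ** 0 = 0. Proof. exact: linear0. Qed.
Lemma omulDl p q r : (p + q) ** r = p ** r + q ** r.
Proof. exact: (linearD (omulr r)). Qed.
Lemma omulDr p q r : r ** (p + q) = r ** p + r ** q. Proof. exact: linearD. Qed.
Lemma omulNl p q : (- p) ** q = - (p ** q). Proof. exact: (linearN (omulr q)). Qed.
Lemma omulNr p q : p ** (- q) = - (p ** q). Proof. exact: linearN. Qed.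
Lemma omulBr p q r : r ** (p - q) = r ** p - r ** q. Proof. exact: linearB. Qed.
Lemma omulZl c p q : (c *: p) ** q = c *: (p ** q).
Proof. exact: (linearZZ (omulr q)). Qed.
Lemma omulZr c p q : p ** (c *: q) = c *: (p ** q). Proof. exact: linearZ. Qed.
Lemma omul_sumr (I : Type) (s : seq I) (Q : pred I) (F : I -> P) q :
  q ** (\sum_(i <- s | Q i) F i) = \sum_(i <- s | Q i) q ** F i.
Proof. exact: linear_sum. Qed.

Definition osgn a b : nat := (\sum_(i < l) \sum_(j < l | (j < i)%N) a i * b j)%N.

Lemma omulXX a b : ('X_[a] : P) ** 'X_[b] = (-1) ^+ osgn a b *: 'X_[(a + b)%MM].
Proof. by rewrite omulE !mextX. Qed.

Lemma osgnDl a b d : osgn (a + b)%MM d = (osgn a d + osgn b d)%N.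
Proof.
rewrite /osgn -big_split; apply: eq_bigr => i _; rewrite -big_split.
by apply: eq_bigr => j _; rewrite mnmDE mulnDl.
Qed.

Lemma osgnDr a b d : osgn a (b + d)%MM = (osgn a b + osgn a d)%N.
Proof.
rewrite /osgn -big_split; apply: eq_bigr => i _; rewrite -big_split.
by apply: eq_bigr => j _; rewrite mnmDE mulnDr.
Qed.

Lemma osgnU i b : osgn U_(i)%MM b = (\sum_(j < l | (j < i)%N) b j)%N.
Proof.
rewrite /osgn (bigD1 i) //= [X in (_ + X)%N]big1 => [|k /negPf nk].
  by rewrite addn0; apply: eq_bigr => j _; rewrite mnm1E eqxx mul1n.
by rewrite big1 // => j _; rewrite mnm1E eq_sym nk.
Qed.

Lemma osgn0l b : osgn 0%MM b = 0%N.
Proof. by rewrite /osgn !big1 // => i _; rewrite big1 // => j _; rewrite mnm0E. Qed.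

Lemma osgn0r b : osgn b 0%MM = 0%N.
Proof.
by rewrite /osgn !big1 // => i _; rewrite big1 // => j _; rewrite mnm0E muln0.
Qed.

(** [osgn] is additive in each argument, so on monomials both bracketings carry the sign exponent
    [osgn a b + osgn a d + osgn b d]. *)
Lemma omulA p q r : p ** (q ** r) = p ** q ** r.
Proof.
elim/mono_ind: p => [|p p' e e'|c p e|a]; rewrite ?omul0l ?omulDl ?e ?e' ?omulZl ?e //.
elim/mono_ind: q => [|p p' e e'|c p e|b];
  rewrite ?(omul0l, omul0r) ?(omulDl, omulDr) ?e ?e' ?(omulZl, omulZr) ?e //.
elim/mono_ind: r => [|p p' e e'|c p e|d]; rewrite ?omul0r ?omulDr ?e ?e' ?omulZr ?e //.
rewrite !omulXX omulZr omulZl !omulXX !scalerA -!exprD osgnDl osgnDr addmA.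
by rewrite addnC -addnA.
Qed.

Lemma omul1l p : 1 ** p = p.
Proof.
elim/mono_ind: p => [|p p' e e'|c p e|a]; rewrite ?omul0r ?omulDr ?e ?e' ?omulZr ?e //.
by rewrite -mpolyX0 omulXX osgn0l scale1r add0m.
Qed.

Lemma omul1r p : p ** 1 = p.
Proof.
elim/mono_ind: p => [|p p' e e'|c p e|a]; rewrite ?omul0l ?omulDl ?e ?e' ?omulZl ?e //.
by rewrite -mpolyX0 omulXX osgn0r scale1r addm0.
Qed.

Lemma omulUX i b :
  X K i ** 'X_[b] = (-1) ^+ (\sum_(j < l | (j < i)%N) b j)%N *: 'X_[(U_(i) + b)%MM].
Proof. by rewrite /X omulXX osgnU. Qed.

Lemma omul_XC i k : i != k -> X K i ** X K k = - (X K k ** X K i).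
Proof.
have key (j m : 'I_l) : (j < m)%N -> X K j ** X K m = - (X K m ** X K j).
  move=> lt; rewrite !omulUX addmC (bigD1 (P := fun n : 'I_l => (n < m)%N) j) //=.
  rewrite mnm1E eqxx !big1 ?scale1r ?scaleN1r ?opprK // => n.
    by rewrite mnm1E eq_sym => /andP[_ /negPf->].
  by rewrite mnm1E -val_eqE /=; lia.
move=> nik; have [/key//|/key->|/val_inj e] := ltngtP i k; rewrite ?opprK //.
by rewrite e eqxx in nik.
Qed.

End LinearExtension.

(** * Words *)

Section Words.
Variables (K : fieldType) (l : nat).
Local Notation P := {mpoly K[l]}.
Implicit Types (c : K) (a b d : 'X_{1..l}) (p q r : P) (i k : 'I_l).
Implicit Types (w u v : seq 'I_l) (j m : nat).

Lemma enum_ord_split i : exists s t, [/\ enum 'I_l = s ++ i :: t,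
  all (fun k : 'I_l => k < i)%N s & all (fun k : 'I_l => i < k)%N t].
Proof.
have : pairwise (fun k m : 'I_l => k < m)%N (enum 'I_l).
  rewrite -(pairwise_map val ltn) val_enum_ord -sorted_pairwise ?iota_ltn_sorted //.
  exact: ltn_trans.
have : i \in enum 'I_l by rewrite mem_enum.
case/splitPr => s t; rewrite pairwise_cat pairwise_cons allrel_consr.
by case/and3P => /andP[h _] _ /andP[h' _]; exists s, t.
Qed.

(** [u] collects the letters of the sorted word of [b] with index below [i]; its length counts the
    letters that a new [i] placed in front must cross. *)
Lemma mword_insert i b : exists u v, [/\ mword b = u ++ v,
  mword (U_(i) + b)%MM = u ++ i :: v, all (fun k => k != i) u
  & size u = (\sum_(j < l | (j < i)%N) b j)%N].
Proof.
have [s [t [e hs ht]]] := enum_ord_split i.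
have ub (r : seq 'I_l) : all (fun k => k != i) r ->
    [seq nseq ((U_(i) + b)%MM k) k | k <- r] = [seq nseq (b k) k | k <- r].
  move=> /allP h; apply/eq_in_map => k /h /negPf nk.
  by rewrite mnmDE mnm1E eq_sym nk.
have hs' : all (fun k => k != i) s.
  by apply: sub_all hs => k; rewrite -val_eqE /=; lia.
have ht' : all (fun k => k != i) t.
  by apply: sub_all ht => k; rewrite -val_eqE /=; lia.
rewrite /mword e !map_cat !flatten_cat !map_cons !ub //= mnmDE mnm1E eqxx add1n /=.
exists (flatten [seq nseq (b k) k | k <- s]).
exists (nseq (b i) i ++ flatten [seq nseq (b k) k | k <- t]); split => //.
  apply/allP => k /flatten_mapP[m ms]; rewrite mem_nseq => /andP[_ /eqP->].
  by move/allP: hs' => /(_ _ ms).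
rewrite size_flatten /shape -map_comp sumnE big_map.
transitivity (\sum_(j <- enum 'I_l | (j < i)%N) b j)%N; last by rewrite big_enum_cond.
rewrite e big_cat big_cons ltnn /= [X in (_ + X)%N]big1_seq ?addn0.
  rewrite big_seq_cond [RHS]big_seq_cond; apply: eq_big => [k|k _]; last by rewrite /= size_nseq.
  by case ks: (k \in s) => //=; move/allP: hs => /(_ _ ks) ->.
by move=> k /andP[] lt kt; move/allP: ht => /(_ _ kt); lia.
Qed.

(** Compatibility with the relations between distinct variables. A skew function is determined by
    its values on sorted words, the only words that [dem] and [osig] use. *)
Definition skew (F : seq 'I_l -> P) :=
  forall u v i k, i != k -> F (u ++ [:: i, k & v]) = - F (u ++ [:: k, i & v]).

Lemma skew_insert F i b : skew F ->
  F (i :: mword b) =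
  (-1) ^+ (\sum_(j < l | (j < i)%N) b j)%N *: F (mword (U_(i) + b)%MM).
Proof.
move=> hF; have [u [v [-> -> h <-]]] := mword_insert i b.
suff gen u0 : F (u0 ++ i :: u ++ v) = (-1) ^+ size u *: F (u0 ++ u ++ i :: v).
  exact: (gen [::]).
elim: u h u0 => [|k u IH] /=; first by move=> _ u0; rewrite scale1r.
case/andP=> nk /IH{}IH u0; rewrite hF 1?eq_sym // -cat_rcons IH cat_rcons.
by rewrite exprS mulN1r scaleNr.
Qed.

Lemma mnm_ind (Q : 'X_{1..l} -> Prop) : Q 0%MM ->
  (forall i a, Q a -> Q (U_(i) + a)%MM) -> forall a, Q a.
Proof.
move=> Q0 QU a; elim: {a}(mdeg a) {-2}a (erefl (mdeg a)) => [|n IH] a.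
  by move/eqP; rewrite mdeg_eq0 => /eqP->.
move=> ea; have /existsP[i hi] : [exists i, a i != 0%N].
  rewrite -negb_forall; apply/negP => /forallP h.
  by move: ea; rewrite mdegE big1 // => i _; apply/eqP/h.
have e : (U_(i) + (a - U_(i)) = a)%MM.
  rewrite addmC submK //; apply/mnm_lepP => k; rewrite mnm1E.
  by case: eqP => // <-; rewrite lt0n.
by rewrite -e; apply/QU/IH; move: ea; rewrite -{1}e mdegD mdeg1 => -[].
Qed.

Lemma prodw_skew : skew (@prodw K l).
Proof.
move=> u v i k nik; elim: u => [|m u IH] /=; last by rewrite IH omulNr.
by rewrite !omulA omul_XC // omulNl.
Qed.

Lemma mword0 : mword (0%MM : 'X_{1..l}) = [::].
Proof. by rewrite /mword; elim: (enum _) => //= i s ->; rewrite mnm0E. Qed.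

Lemma sgnK n p : (-1) ^+ n *: ((-1) ^+ n *: p) = p.
Proof. by rewrite scalerA -exprD addnn -mul2n exprM sqrrN !expr1n scale1r. Qed.

Lemma prodw_mword a : prodw K (mword a) = 'X_[a].
Proof.
elim/mnm_ind: a => [|i a IH]; first by rewrite mword0 /= mpolyX0.
have := skew_insert i a prodw_skew; rewrite /= IH omulUX.
by move/(congr1 (fun p => (-1) ^+ (\sum_(j < l | (j < i)%N) a j)%N *: p)); rewrite !sgnK.
Qed.

Lemma letter_ind (Q : P -> Prop) : Q 1 -> (forall p q, Q p -> Q q -> Q (p + q)) ->
  (forall c p, Q p -> Q (c *: p)) -> (forall i p, Q p -> Q (X K i ** p)) ->
  forall p, Q p.
Proof.
move=> Q1 QD QZ QX; elim/mono_ind => // [|a]; first by rewrite -(scale0r 1); apply: QZ.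
by rewrite -prodw_mword; elim: (mword a) => //= i w; apply: QX.
Qed.

(** Sorting [w] changes [prodw K w] and [F w] by the same sign, so an extension defined through
    sorted words has the right value on every word. *)
Lemma mext_skew_word (F : seq 'I_l -> P) w : skew F ->
  mext (fun a => F (mword a)) (prodw K w) = F w.
Proof.
move=> hF; suff [a [n [-> ->]]] : exists a n,
    prodw K w = (-1) ^+ n *: 'X_[a] /\ F w = (-1) ^+ n *: F (mword a).
  by rewrite linearZ /= mextX.
elim: w F hF => [|i w IH] F hF.
  by exists 0%MM, 0%N; rewrite mpolyX0 mword0 !scale1r.
have /IH[a [n [e e']]] : skew (fun w => F (i :: w)).
  by move=> u v k m; apply: (hF (i :: u)).
exists (U_(i) + a)%MM, (n + \sum_(j < l | (j < i)%N) a j)%N.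
rewrite /= e e' omulZr omulUX skew_insert // !scalerA -!exprD.
by split.
Qed.

End Words.

(** * Odd Demazure operators *)

Section Demazure.
Variables (K : fieldType) (l : nat).
Local Notation P := {mpoly K[l]}.
Local Notation X := (@X K l).
Implicit Types (c : K) (a b d : 'X_{1..l}) (p q r : P) (i k : 'I_l).
Implicit Types (w u v : seq 'I_l) (j : nat).

Definition dcoef j i : K := (i == j :> nat)%:R - (i == j.+1 :> nat)%:R.

Lemma dx_mul j i p : dx K j i ** p = dcoef j i *: p.
Proof. by rewrite /dx omulZl omul1l. Qed.

Lemma sxE j i k m : i = j :> nat -> k = j.+1 :> nat ->
  sx K j m = if m == i then X k else if m == k then X i else - X m.
Proof.
move=> ei ek; rewrite /sx -ek -ei !val_eqE.
by rewrite !big_pred1_eq.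
Qed.

Lemma dcoefE j i k m : i = j :> nat -> k = j.+1 :> nat ->
  dcoef j m = if m == i then 1 else if m == k then -1 else 0.
Proof.
move=> ei ek; rewrite /dcoef -ek -ei !val_eqE.
have [->|_] := eqVneq m i; last by case: eqP; rewrite /= mulr0n sub0r ?oppr0.
by rewrite -val_eqE /= ek ei ltn_eqF // subr0.
Qed.

Lemma ord_pair j : (j.+1 < l)%N ->
  exists i k : 'I_l, [/\ i = j :> nat, k = j.+1 :> nat, k != i & i != k].
Proof.
move=> hj; exists (Ordinal (ltnW hj)), (Ordinal hj).
by split => //; rewrite -val_eqE /=; lia.
Qed.

Lemma sx_skew j i k : (j.+1 < l)%N -> i != k ->
  sx K j i ** sx K j k = - (sx K j k ** sx K j i).
Proof.
move=> /ord_pair[m [n [em en nm mn]]] nik; rewrite !(sxE _ em en).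
case: (eqVneq i m) => [e|nim]; [|case: (eqVneq i n) => [e|nin]];
  (case: (eqVneq k m) => [e'|nkm]; [|case: (eqVneq k n) => [e'|nkn]]);
  rewrite ?omulNl ?omulNr ?opprK; subst; rewrite ?eqxx // in nik *;
  by rewrite omul_XC ?opprK // eq_sym.
Qed.

(** The two sides come from the twisted Leibniz rule applied to the relation
    [X i ** X k = - (X k ** X i)]; their equality makes the operator well defined. *)
Lemma sx_dc_skew j i k : (j.+1 < l)%N -> i != k ->
  dcoef j i *: X k + dcoef j k *: sx K j i = - (dcoef j k *: X i + dcoef j i *: sx K j k).
Proof.
move=> /ord_pair[m [n [em en nm mn]]] nik; rewrite !(sxE _ em en) !(dcoefE _ em en).
case: (eqVneq i m) => [e|nim]; [|case: (eqVneq i n) => [e|nin]];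
  (case: (eqVneq k m) => [e'|nkm]; [|case: (eqVneq k n) => [e'|nkn]]);
  subst; rewrite ?eqxx // in nik *;
  by rewrite ?(scale1r, scaleN1r, scale0r, addr0, add0r, oppr0, opprK, opprD, addrN, subrr, addNr).
Qed.

Lemma sword_skew j : (j.+1 < l)%N -> skew (@sword K l j).
Proof.
move=> hj u v i k nik; elim: u => [|m u IH] /=; last by rewrite IH omulNr.
by rewrite !omulA sx_skew // omulNl.
Qed.

Lemma dword_skew j : (j.+1 < l)%N -> skew (@dword K l j).
Proof.
move=> hj u v i k nik; elim: u => [|m u IH] /=; last first.
  by rewrite IH prodw_skew // !omulNr opprD.
rewrite !dx_mul !omulDr !omulZr !omulA -!omulZl !addrA -!omulDl.
by rewrite sx_dc_skew // sx_skew // !omulNl -opprD.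
Qed.

Lemma osig_is_linear j : linear (@osig K l j).
Proof. exact: mext_is_linear. Qed.
HB.instance Definition _ j :=
  GRing.isLinear.Build K P P *:%R (@osig K l j) (osig_is_linear j).

Lemma dem_is_linear j : linear (@dem K l j).
Proof. exact: mext_is_linear. Qed.
HB.instance Definition _ j :=
  GRing.isLinear.Build K P P *:%R (@dem K l j) (dem_is_linear j).

Lemma osigD j p q : osig j (p + q) = osig j p + osig j q. Proof. exact: linearD. Qed.
Lemma osigN j p : osig j (- p) = - osig j p. Proof. exact: linearN. Qed.
Lemma osigZ j c p : osig j (c *: p) = c *: osig j p. Proof. exact: linearZZ. Qed.
Lemma dem0 j : dem j (0 : P) = 0. Proof. exact: linear0. Qed.
Lemma demD j p q : dem j (p + q) = dem j p + dem j q. Proof. exact: linearD. Qed.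
Lemma demN j p : dem j (- p) = - dem j p. Proof. exact: linearN. Qed.
Lemma demZ j c p : dem j (c *: p) = c *: dem j p. Proof. exact: linearZZ. Qed.

Lemma osig1 j : osig j (1 : P) = 1.
Proof. by rewrite /osig -/(mext _ _) -mpolyX0 mextX mword0 /= mpolyX0. Qed.

Lemma dem1 j : dem j (1 : P) = 0.
Proof. by rewrite /dem -/(mext _ _) -mpolyX0 mextX mword0. Qed.

Lemma osigXl j i p : (j.+1 < l)%N -> osig j (X i ** p) = sx K j i ** osig j p.
Proof.
move=> hj; elim/mono_ind: p => [|p q e e'|c p e|a].
- by rewrite !(omul0r, linear0).
- by rewrite !(omulDr, demD, osigD) e e'.
- by rewrite omulZr !(demZ, osigZ) e omulZr.
rewrite -prodw_mword (_ : X i ** _ = prodw K (i :: mword a)) //.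
by rewrite /osig -!/(mext _ _) !(mext_skew_word _ (sword_skew hj)).
Qed.

Lemma demXl j i p : (j.+1 < l)%N ->
  dem j (X i ** p) = dcoef j i *: p + sx K j i ** dem j p.
Proof.
move=> hj; elim/mono_ind: p => [|p q e e'|c p e|a].
- by rewrite !(omul0r, linear0, scaler0, addr0).
- by rewrite !(omulDr, demD, osigD) e e' ?omulDr ?scalerDr addrACA.
- by rewrite omulZr !demZ e omulZr scalerDr !scalerA mulrC.
rewrite -prodw_mword (_ : X i ** _ = prodw K (i :: mword a)) //.
by rewrite /dem -!/(mext _ _) !(mext_skew_word _ (dword_skew hj)) /= dx_mul.
Qed.

Lemma osigX j i : (j.+1 < l)%N -> osig j (X i) = sx K j i.
Proof. by move=> hj; rewrite -[X i]omul1r osigXl // osig1 omul1r. Qed.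

Lemma demX j i : (j.+1 < l)%N -> dem j (X i) = dcoef j i *: 1.
Proof. by move=> hj; rewrite -[X i]omul1r demXl // dem1 omul0r addr0. Qed.

(** Induction on the left factor, which uses [osig] only on products whose first factor is a
    variable. *)
Lemma demM j p q : (j.+1 < l)%N -> dem j (p ** q) = dem j p ** q + osig j p ** dem j q.
Proof.
move=> hj; elim/letter_ind: p => [|p p' e e'|c p e|i p e].
- by rewrite osig1 dem1 !omul1l omul0l add0r.
- by rewrite omulDl !(demD, osigD) !omulDl e e' addrACA.
- by rewrite omulZl !(demZ, osigZ) !omulZl e scalerDr.
by rewrite -omulA !demXl // osigXl // e omulDl omulDr omulZl !omulA addrA.
Qed.

Lemma dem_sx j i : (j.+1 < l)%N -> dem j (sx K j i) = - (dcoef j i *: 1).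
Proof.
move=> hj; have [m [n [em en nm mn]]] := ord_pair hj.
rewrite (sxE _ em en) (dcoefE _ em en).
case: (eqVneq i m) => [_|nim]; [|case: (eqVneq i n) => [_|nin]].
- by rewrite demX // (dcoefE _ em en) eqxx (negPf nm) scaleN1r scale1r.
- by rewrite demX // (dcoefE _ em en) eqxx scaleN1r opprK scale1r.
by rewrite ?(demN, osigN) demX // (dcoefE _ em en) (negPf nim) (negPf nin) !scale0r.
Qed.

(** On [X i ** p] the Leibniz rule leaves [dcoef j i *: dem j p] and [dem j (sx K j i) ** dem j p],
    which cancel. *)
Lemma dem_dem j p : (j.+1 < l)%N -> dem j (dem j p) = 0.
Proof.
move=> hj; elim/letter_ind: p => [|p p' e e'|c p e|i p e].
- by rewrite dem1 linear0.
- by rewrite !(demD, osigD) e e' addr0.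
- by rewrite !(demZ, osigZ) e scaler0.
rewrite demXl // demD demZ demM // dem_sx // e omul0r addr0.
by rewrite omulNl omulZl omul1l subrr.
Qed.

(** On [X k ** p] the terms with one operator are [dcoef j k *: dem i p - dcoef i k *: dem j p],
    antisymmetric in [i] and [j]; the remaining term follows by induction because the two
    automorphisms commute on variables. *)
Lemma demC (i j : nat) p : (i.+1 < j)%N -> (j.+1 < l)%N ->
  dem i (dem j p) = - dem j (dem i p).
Proof.
move=> hij hj; have hi : (i.+1 < l)%N by lia.
have [m [n [em en nm mn]]] := ord_pair hi.
have [m' [n' [em' en' nm' mn']]] := ord_pair hj.
have [h1 h2 h3 h4] : [/\ m == m' = false, m == n' = false, n == m' = false & n == n' = false].
  by rewrite -!val_eqE /=; split; lia.
have [h1' h2' h3' h4'] : [/\ m' == m = false, n' == m = false, m' == n = false & n' == n = false].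
  by rewrite -!val_eqE /=; split; lia.
have ds k : dem i (sx K j k) = - (dcoef i k *: 1).
  rewrite (sxE _ em' en') (dcoefE _ em en).
  have [->|] := eqVneq k m; first by rewrite h1 h2 ?(demN, osigN) demX // (dcoefE _ em en) eqxx.
  have [->|] := eqVneq k n; first by rewrite h3 h4 ?(demN, osigN) demX // (dcoefE _ em en) eqxx (negPf nm).
  have [->|n1] := eqVneq k m'; first by rewrite demX // (dcoefE _ em en) h2' h4' scale0r oppr0.
  have [->|n2] := eqVneq k n'; first by rewrite demX // (dcoefE _ em en) h1' h3' scale0r oppr0.
  move=> /negPf n3 /negPf n4.
  by rewrite ?(demN, osigN) demX // (dcoefE _ em en) n3 n4.
have ds' k : dem j (sx K i k) = - (dcoef j k *: 1).
  rewrite (sxE _ em en) (dcoefE _ em' en').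
  have [->|] := eqVneq k m'; first by rewrite h1' h3' ?(demN, osigN) demX // (dcoefE _ em' en') eqxx.
  have [->|] := eqVneq k n'; first by rewrite h2' h4' ?(demN, osigN) demX // (dcoefE _ em' en') eqxx (negPf nm').
  have [->|n1] := eqVneq k m; first by rewrite demX // (dcoefE _ em' en') h3 h4 scale0r oppr0.
  have [->|n2] := eqVneq k n; first by rewrite demX // (dcoefE _ em' en') h1 h2 scale0r oppr0.
  move=> /negPf n3 /negPf n4.
  by rewrite ?(demN, osigN) demX // (dcoefE _ em' en') n3 n4.
have ss k : osig i (sx K j k) = osig j (sx K i k).
  rewrite (sxE _ em en) (sxE _ em' en').
  have [->|/negPf n1] := eqVneq k m.
    by rewrite h1 h2 ?(demN, osigN) !osigX // !(sxE _ em' en', sxE _ em en) eqxx h3 h4.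
  have [->|/negPf n2] := eqVneq k n.
    by rewrite h3 h4 ?(demN, osigN) !osigX // !(sxE _ em' en', sxE _ em en) eqxx h1 h2 (negPf nm).
  have [->|/negPf n3] := eqVneq k m'.
    by rewrite ?(demN, osigN) !osigX // !(sxE _ em' en', sxE _ em en) eqxx h2' h4'.
  have [->|/negPf n4] := eqVneq k n'.
    by rewrite ?(demN, osigN) !osigX // !(sxE _ em' en', sxE _ em en) eqxx h1' h3' (negPf nm').
  by rewrite !(demN, osigN) !osigX // !(sxE _ em' en', sxE _ em en) n1 n2 n3 n4.
elim/letter_ind: p => [|p p' e e'|c p e|k p e].
- by rewrite !(dem1, dem0) oppr0.
- by rewrite !(demD, osigD) e e' opprD.
- by rewrite !(demZ, osigZ) e scalerN.
rewrite !demXl // !(demD, osigD) !(demZ, osigZ) !demM // ds ds' ss e.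
rewrite !omulNl !omulZl !omul1l !opprD !opprK omulNr addrA.
by rewrite addrCA addrA.
Qed.

Lemma dem_dem_sx (i i' i'' : nat) k : (i.+1 < l)%N -> (i'.+1 < l)%N -> (i''.+1 < l)%N ->
  dem i (dem i' (sx K i'' k)) = 0.
Proof.
move=> hi hi' hi''; have [m [n [em en _ _]]] := ord_pair hi''; rewrite (sxE _ em en).
by do 2?case: ifP => _; rewrite ?demN demX // demZ dem1 ?oppr0 scaler0 ?oppr0.
Qed.

(** On [X k ** p] the terms with a repeated operator vanish. There remain [dcoef i k *: dem i (dem
    i.+1 p) - dcoef i.+1 k *: dem i.+1 (dem i p)], antisymmetric under exchange of [i] and [i.+1],
    and a term covered by induction. *)
Lemma dem_braid (i : nat) p : (i.+2 < l)%N ->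
  dem i (dem i.+1 (dem i p)) = - dem i.+1 (dem i (dem i.+1 p)).
Proof.
move=> hi2; have hi : (i.+1 < l)%N by lia.
have [m [n [em en nm mn]]] := ord_pair hi.
have [n' [t [en' et tn nt]]] := ord_pair hi2.
have e : n' = n by apply: val_inj; rewrite /= en en'.
subst n'; clear en'.
have [mt tm] : m == t = false /\ t == m = false by rewrite -!val_eqE /=; split; lia.
have {}nm := negPf nm; have {}mn := negPf mn; have {}tn := negPf tn; have {}nt := negPf nt.
have en2 : n = i.+1 :> nat by [].
have sS k := sxE k em en; have sT k := sxE k en2 et.
have dS k := dcoefE k em en; have dT k := dcoefE k en2 et.
have sSX k : osig i (X k) = if k == m then X n else if k == n then X m else - X k.
  by rewrite osigX // sS.
have sTX k : osig i.+1 (X k) = if k == n then X t else if k == t then X n else - X k.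
  by rewrite osigX // sT.
have dSX k : dem i (X k) = (if k == m then 1 else if k == n then -1 else 0) *: 1.
  by rewrite demX // dS.
have dTX k : dem i.+1 (X k) = (if k == n then 1 else if k == t then -1 else 0) *: 1.
  by rewrite demX // dT.
pose E := (nm, mn, tn, nt, mt, tm, @eqxx 'I_l).
have cases (Q : 'I_l -> Prop) : Q m -> Q n -> Q t ->
    (forall k, k == m = false -> k == n = false -> k == t = false -> Q k) -> forall k, Q k.
  move=> Qm Qn Qt Qk k; have [->//|/negPf ?] := eqVneq k m.
  by have [->//|/negPf ?] := eqVneq k n; have [->//|/negPf ?] := eqVneq k t; apply: Qk.
(* The braid relation of the automorphisms, on variables. *)
have r1 k : osig i (osig i.+1 (sx K i k)) = osig i.+1 (osig i (sx K i.+1 k)).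
  rewrite sS sT; elim/cases: k => [|||k h1 h2 h3];
  by rewrite ?h1 ?h2 ?h3 ?E ?osigN ?(sSX, sTX) ?h1 ?h2 ?h3 ?E
    ?osigN ?(sSX, sTX) ?h1 ?h2 ?h3 ?E ?opprK.
have r2 k : dem i.+1 (osig i (sx K i.+1 k)) = - (dcoef i k *: 1).
  rewrite dS sT; elim/cases: k => [|||k h1 h2 h3];
  by rewrite ?h1 ?h2 ?h3 ?E ?osigN ?(sSX, sTX) ?h1 ?h2 ?h3 ?E
    ?demN ?(dSX, dTX) ?h1 ?h2 ?h3 ?E ?(scale1r, scaleN1r, scale0r, opprK, oppr0).
have r3 k : dem i (osig i.+1 (sx K i k)) = - (dcoef i.+1 k *: 1).
  rewrite dT sS; elim/cases: k => [|||k h1 h2 h3];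
  by rewrite ?h1 ?h2 ?h3 ?E ?osigN ?(sSX, sTX) ?h1 ?h2 ?h3 ?E
    ?demN ?(dSX, dTX) ?h1 ?h2 ?h3 ?E ?(scale1r, scaleN1r, scale0r, opprK, oppr0).
clear -hi hi2 r1 r2 r3.
elim/letter_ind: p => [|p p' e e'|c p e|k p e].
- by rewrite !(dem1, dem0) oppr0.
- by rewrite !(demD, osigD) e e' opprD.
- by rewrite !(demZ, osigZ) e scalerN.
rewrite !demXl // !(demD, osigD) !(demZ, osigZ) !demM // !(demD, osigD) !demM //.
rewrite !dem_dem // r1 r2 r3.
by rewrite !dem_dem_sx // !(omul0r, omul0l, addr0, add0r) !omulNl !omulZl !omul1l e
  omulNr !opprD !opprK addrCA !addrA.
Qed.

End Demazure.

(** * Length of permutations *)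

Section Length.
Variable l : nat.
Implicit Types (u v w : 'S_l) (i k m n : 'I_l) (j : nat) (s t : seq nat).

Definition inv_set w : {set 'I_l * 'I_l} :=
  [set p : 'I_l * 'I_l | (p.1 < p.2)%N && (w p.2 < w p.1)%N].

Lemma sjE j i k : i = j :> nat -> k = j.+1 :> nat -> sj l j = tperm i k.
Proof.
move=> ei ek; rewrite /sj.
case: insubP => [a _ ea|]; last by rewrite -ei ltn_ord.
case: insubP => [b _ eb|]; last by rewrite -ek ltn_ord.
by congr tperm; apply: val_inj; rewrite /= ?ea ?eb.
Qed.

Lemma sjK j : (sj l j * sj l j = 1)%g.
Proof.
rewrite /sj; case: (insub j : option 'I_l) => [a|]; last by rewrite mulg1.
by case: (insub j.+1 : option 'I_l) => [b|]; rewrite ?tperm2 ?mulg1.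
Qed.

Lemma sjV j : ((sj l j)^-1 = sj l j)%g.
Proof. by rewrite -[RHS]mul1g -(mulVg (sj l j)) -mulgA sjK mulg1. Qed.

Lemma sjKl j w : (sj l j * (sj l j * w) = w)%g.
Proof. by rewrite mulgA sjK mul1g. Qed.

Lemma plen_asc j i k w : i = j :> nat -> k = j.+1 :> nat -> (w i < w k)%N ->
  plen (sj l j * w)%g = (plen w).+1.
Proof.
move=> ei ek asc; rewrite (sjE ei ek) /plen -!/(inv_set _).
set t := tperm i k; pose f (p : 'I_l * 'I_l) := (t p.1, t p.2).
have fK : involutive f by case=> a b; rewrite /f /= !tpermK.
have tE a : t a = if a == i then k else if a == k then i else a.
  by rewrite /t; case: tpermP => [->|->|/eqP/negPf-> /eqP/negPf->] //;
     rewrite ?eqxx //; case: eqP.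
rewrite (cardsD1 (i, k)) inE /= ek ei ltnSn !permM /=.
rewrite /t tpermL tpermR asc add1n; congr _.+1.
rewrite -(card_preimset (inv_set w) (inv_inj fK)); apply: eq_card => -[a b].
rewrite !inE /= !permM /= xpair_eqE.
have ltwN : (w k < w i)%N = false by lia.
have [->{a}|nai] := eqVneq a i; have [->{b}|nbk] := eqVneq b k => //=.
- by rewrite /t tpermL tpermR ek ei; lia.
- rewrite !tE eqxx; case: (eqVneq b i) => [->|nbi]; first by rewrite !ltnn.
  by rewrite (negPf nbk); congr andb; move: nbk nbi; rewrite -!val_eqE /=; lia.
- rewrite !tE (negPf nai) eqxx; case: (eqVneq k i) => [e|nki]; first by rewrite e ltnn in asc.
  case: (eqVneq a k) => [->|nak]; first by rewrite !ltnn.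
  by congr andb; move: nak nai; rewrite -!val_eqE /=; lia.
rewrite !tE (negPf nai) (negPf nbk).
case: (eqVneq a k) => [->|nak]; case: (eqVneq b i) => [->|nbi].
- by rewrite ltwN !andbF.
- by congr andb; move: nbk nbi; rewrite -!val_eqE /=; lia.
- by congr andb; move: nak nai; rewrite -!val_eqE /=; lia.
by [].
Qed.

Lemma plen_desc j i k w : i = j :> nat -> k = j.+1 :> nat -> (w k < w i)%N ->
  plen w = (plen (sj l j * w)%g).+1.
Proof.
move=> ei ek desc; rewrite -{1}(sjKl j w) (plen_asc ei ek) //.
by rewrite (sjE ei ek) !permM tpermL tpermR.
Qed.

Lemma perm_neq_ltn w i k : i != k -> (w k < w i)%N = ~~ (w i < w k)%N.
Proof.
move=> nik; rewrite -leqNgt ltn_neqAle val_eqE.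
by rewrite (inj_eq (@perm_inj _ w)) eq_sym nik.
Qed.

Lemma plen_lt_desc j i k w : i = j :> nat -> k = j.+1 :> nat ->
  (plen (sj l j * w)%g < plen w)%N = (w k < w i)%N.
Proof.
move=> ei ek; have nik : i != k by rewrite -val_eqE /= ei ek; lia.
rewrite perm_neq_ltn //; case asc: (w i < w k)%N.
  by rewrite (plen_asc ei ek asc) ltnNge leqnSn.
have := perm_neq_ltn w nik; rewrite asc => /(plen_desc ei ek) ->.
by rewrite ltnSn.
Qed.

Lemma plen_sjl j w : (j.+1 < l)%N ->
  plen (sj l j * w)%g = (plen w).+1 \/ plen w = (plen (sj l j * w)%g).+1.
Proof.
move=> /ord_pair[i [k [ei ek _ nik]]]; case asc: (w i < w k)%N.
  by left; apply: (plen_asc ei ek).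
by right; apply: (plen_desc ei ek); rewrite perm_neq_ltn // asc.
Qed.

Lemma plenV w : plen w^-1%g = plen w.
Proof.
pose g (p : 'I_l * 'I_l) := (w p.2, w p.1).
have gI : injective g by move=> [a b] [c d] [/perm_inj-> /perm_inj->].
rewrite /plen -!/(inv_set _) -(card_preimset (inv_set w^-1%g) gI).
by apply: eq_card => -[a b]; rewrite !inE /= !permK andbC.
Qed.

Lemma plen_sjr j w : (j.+1 < l)%N ->
  plen (w * sj l j)%g = (plen w).+1 \/ plen w = (plen (w * sj l j)%g).+1.
Proof.
by rewrite -(plenV (w * _)%g) -(plenV w) invMg sjV; apply: plen_sjl.
Qed.

(** This is $l(l-1)/2$, the largest length of a permutation and also the degree of [xi]. *)
Definition maxlen : nat := (\sum_(i < l) (l - i.+1))%N.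

Lemma card_ltn_pairs : #|[set p : 'I_l * 'I_l | (p.1 < p.2)%N]| = maxlen.
Proof.
rewrite -sum1dep_card -(pair_big_dep xpredT (fun i k : 'I_l => (i < k)%N) (fun _ _ => 1%N)) /=.
apply: eq_bigr => i _; rewrite -(big_mkord (fun x : nat => (i < x)%N) (fun _ => 1%N)).
rewrite (big_cat_nat (n := i.+1)) //= big1_seq ?add0n.
  rewrite -[RHS]muln1 -sum_nat_const_nat big_nat_cond [RHS]big_nat_cond.
  by apply: eq_bigl => x; lia.
by move=> x /andP[] h; rewrite mem_index_iota; lia.
Qed.

(** Reversing the values exchanges inversions and non-inversions. *)
Lemma plen_wlong u : (plen (u * wlong l)%g + plen u = maxlen)%N.
Proof.
rewrite -card_ltn_pairs -(cardsID (inv_set u)) addnC; congr (_ + _)%N.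
  by apply: eq_card => p; rewrite !inE andbA andbb.
apply: eq_card => -[a b]; rewrite !inE /= !permM /wlong !permE /=.
case lt: (a < b)%N; rewrite ?andbF //= andbT -leqNgt.
have nab : a != b by rewrite -val_eqE /=; lia.
have : u a != u b by rewrite (inj_eq perm_inj).
have := ltn_ord (u a); have := ltn_ord (u b).
by rewrite -val_eqE /=; lia.
Qed.

Lemma plen_le w : (plen w <= maxlen)%N.
Proof. by rewrite -(plen_wlong w) leq_addl. Qed.

Definition valid_word s := all (fun j => j.+1 < l)%N s.

Lemma wprod_cons j s : wprod l (j :: s) = (sj l j * wprod l s)%g.
Proof. by rewrite /wprod big_cons. Qed.

Lemma wprod_cat s t : wprod l (s ++ t) = (wprod l s * wprod l t)%g.
Proof. by rewrite /wprod big_cat. Qed.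

Lemma plen1 : plen (1%g : 'S_l) = 0%N.
Proof. by apply: eq_card0 => p; rewrite !inE !permE; lia. Qed.

Lemma plen_wprod s : valid_word s -> (plen (wprod l s) <= size s)%N.
Proof.
elim: s => [|j s IH] /=; first by rewrite /wprod big_nil plen1.
case/andP=> hj /IH; rewrite wprod_cons; case: (plen_sjl (wprod l s) hj); lia.
Qed.

End Length.

(** * Independence of the reduced word *)

Section Matsumoto.
Variables (K : fieldType) (l : nat) (red : 'S_l -> seq nat).
Hypothesis hred : forall w, reduced_word w (red w).
Local Notation P := {mpoly K[l]}.
Local Notation demw := (@demw K l).
Implicit Types (c : K) (p q r : P) (u w : 'S_l) (s t : seq nat).

(** Braid moves change [demw] by a sign; equality up to a nonzero scalar absorbs it. *)
Definition proportional (f g : P -> P) :=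
  exists2 c, c != 0 & forall p, f p = c *: g p.

Lemma proportional_refl f : proportional f f.
Proof. by exists 1; rewrite ?oner_neq0 // => p; rewrite scale1r. Qed.

Lemma proportional_sym f g : proportional f g -> proportional g f.
Proof.
case=> c nc e; exists c^-1 => [|p]; first by rewrite invr_eq0.
by rewrite e scalerA mulVf // scale1r.
Qed.

Lemma proportional_trans g f h :
  proportional f g -> proportional g h -> proportional f h.
Proof.
case=> c nc e [c' nc' e']; exists (c * c') => [|p]; first by rewrite mulf_neq0.
by rewrite e e' scalerA.
Qed.

Lemma proportional_demw s t j : proportional (demw s) (demw t) ->
  proportional (demw (j :: s)) (demw (j :: t)).
Proof. by case=> c nc e; exists c => // p; rewrite /demw /= -/(demw _ _) e demZ. Qed.

Lemma proportionalN f g : (forall p, f p = - g p) -> proportional f g.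
Proof. by move=> e; exists (-1) => [|p]; rewrite ?oppr_eq0 ?oner_neq0 ?e ?scaleN1r. Qed.

Lemma plen_wprod_tl j s : valid_word l (j :: s) -> size (j :: s) = plen (wprod l (j :: s)) ->
  size s = plen (wprod l s) /\ (plen (wprod l s) < plen (wprod l (j :: s)))%N.
Proof.
case/andP=> hj hs; rewrite wprod_cons /=.
by have := plen_wprod hs; case: (plen_sjl (wprod l s) hj); lia.
Qed.

(** Induction on length in the manner of Matsumoto. If the first letters differ, both are left
    descents of the common product [u], so [u] has reduced words starting with either form of the
    longest word in these two letters; the two forms give proportional operators. The function [red]
    supplies the rest of these words. *)
Lemma reduced_demw_eq s t : valid_word l s -> valid_word l t ->
  wprod l s = wprod l t -> size s = plen (wprod l s) -> size t = plen (wprod l t) ->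
  proportional (demw s) (demw t).
Proof.
have [n] := ubnP (size s); elim: n s t => // n IH.
have main i j s t : (size s < n)%N -> (i < j)%N ->
    valid_word l (i :: s) -> valid_word l (j :: t) ->
    wprod l (i :: s) = wprod l (j :: t) ->
    size (i :: s) = plen (wprod l (i :: s)) -> size (j :: t) = plen (wprod l (j :: t)) ->
    proportional (demw (i :: s)) (demw (j :: t)).
  move=> sn lij vs vt est rs rt.
  have [rs' ds] := plen_wprod_tl vs rs; have [rt' dt] := plen_wprod_tl vt rt.
  set u := wprod l (i :: s) in est rs ds; rewrite -est in rt dt.
  have es : wprod l s = (sj l i * u)%g by rewrite /u wprod_cons sjKl.
  have et : wprod l t = (sj l j * u)%g by rewrite est wprod_cons sjKl.
  rewrite es in rs' ds; rewrite et in rt' dt.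
  have [hi hs] := andP vs; have [hj ht] := andP vt.
  have [a [b [ea eb nba nab]]] := ord_pair hi.
  have [a' [b' [ea' eb' nba' nab']]] := ord_pair hj.
  rewrite (plen_lt_desc u ea eb) in ds; rewrite (plen_lt_desc u ea' eb') in dt.
  have si := sjE ea eb; have sJ := sjE ea' eb'.
  have stn : size s = size t by move: rs rt => /= <- [].
  (* Distant letters: [i, j] and [j, i], each followed by [red u'], interpolate between the two
     given words. *)
  have [eij|nij] := eqVneq j i.+1; last first.
    have far : [/\ a != a', a != b', b != a' & b != b'].
      by rewrite -!val_eqE /=; split; lia.
    case: far => aa ab ba bb.
    have comm : (sj l i * sj l j = sj l j * sj l i)%g.
      by rewrite conjgC si sJ tpermJ !tpermD // eq_sym.
    set u' := (sj l j * (sj l i * u))%g.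
    have eu' : u' = (sj l i * (sj l j * u))%g by rewrite /u' !mulgA comm.
    have du' : plen (sj l i * u)%g = (plen u').+1.
      apply: (plen_desc ea' eb'); rewrite !permM si !tpermD //.
    have [vr [er sr]] := hred u'.
    have p1 : proportional (demw s) (demw (j :: red u')).
      apply: IH => //; rewrite ?wprod_cons ?er ?es //; first exact/andP.
        by rewrite /u' sjKl.
      by rewrite /u' sjKl /= sr du'.
    have eiu' : (sj l i * u' = sj l j * u)%g by rewrite eu' sjKl.
    have p2 : proportional (demw t) (demw (i :: red u')).
      apply: IH => //; rewrite -?stn // ?wprod_cons ?er ?et ?eiu' //; first exact/andP.
        by rewrite stn.
      by rewrite -rt' -stn rs' du' /= sr.
    apply: proportional_trans (proportional_demw i p1) _.
    apply: proportional_sym; apply: proportional_trans (proportional_demw j p2) _.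
    apply: proportional_sym; apply: proportionalN => p.
    by rewrite /Defs.demw /=; apply: demC => //; lia.
  (* Adjacent letters share the position [b]. The two descents give [u b' < u b < u a], so each of
     the three successive braid letters lowers the length. *)
  have e : a' = b by apply: val_inj; rewrite /= ea' eb.
  rewrite {}eij in vt est rt dt et rt' hj ea' eb' sJ *; subst a'.
  have nab2 : a != b' by rewrite -val_eqE /=; lia.
  have braid : (sj l i * (sj l i.+1 * sj l i) = sj l i.+1 * (sj l i * sj l i.+1))%g.
    have tE : tperm b b' = (tperm a b' ^ tperm a b)%g.
      by rewrite tpermJ tpermL tpermD.
    rewrite mulgA {1}[(sj l i * sj l i.+1)%g]conjgC -mulgA; congr (_ * _)%g.
    have b'a : b' != a by rewrite eq_sym.
    by rewrite si sJ tpermJ tpermL (tpermD nba b'a) {1}conjgC -tE.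
  pose u2 := (sj l i.+1 * (sj l i * u))%g.
  pose u' := (sj l i * u2)%g.
  have d2 : plen (sj l i * u)%g = (plen u2).+1.
    apply: (plen_desc ea' eb'); rewrite !permM si tpermR tpermD //.
    exact: ltn_trans dt ds.
  have d3 : plen u2 = (plen u').+1.
    apply: (plen_desc ea eb); rewrite !permM si sJ.
    have [b'a bb'] : b' != a /\ b != b' by rewrite eq_sym.
    by rewrite tpermL (tpermD nab2 bb') (tpermD nba b'a) tpermL.
  have [vr [er sr]] := hred u'.
  have eu' : (sj l i.+1 * u' = sj l i * (sj l i.+1 * u))%g.
    rewrite /u' /u2 !mulgA -[(sj l i.+1 * sj l i * sj l i.+1)%g]mulgA -braid.
    by rewrite -!mulgA sjKl.
  have v2 : valid_word l [:: i.+1, i & red u'] by apply/and3P.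
  have v2' : valid_word l [:: i, i.+1 & red u'] by apply/and3P.
  have p1 : proportional (demw s) (demw [:: i.+1, i & red u']).
    apply: IH => //; rewrite ?wprod_cons ?er ?es /u' /u2 ?sjKl //.
    by rewrite /= sr d2 d3.
  have eiu' : (sj l i * (sj l i.+1 * u') = sj l i.+1 * u)%g by rewrite eu' sjKl.
  have p2 : proportional (demw t) (demw [:: i, i.+1 & red u']).
    apply: IH => //; rewrite -?stn // ?wprod_cons ?er ?eiu' ?et //; first by rewrite stn.
    by rewrite -rt' -stn rs' d2 d3 /= sr.
  apply: proportional_trans (proportional_demw i p1) _.
  apply: proportional_sym; apply: proportional_trans (proportional_demw i.+1 p2) _.
  apply: proportional_sym; apply: proportionalN => p.
  by rewrite /Defs.demw /=; apply: dem_braid.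
case=> [|i s] [|j t] //; rewrite ?ltnS => sn vs vt est rs rt.
- exact: proportional_refl.
- by move: rt; rewrite -est -rs.
- by move: rs; rewrite est -rt.
have [lij|lji|eij] := ltngtP i j; first exact: main.
  apply/proportional_sym/main => //; suff : size t = size s by move=> ->.
  by move: rs; rewrite est -rt => -[].
subst j; apply: proportional_demw; have [[_ vs'] [_ vt']] := (andP vs, andP vt).
have [rs' _] := plen_wprod_tl vs rs; have [rt' _] := plen_wprod_tl vt rt.
by apply: IH => //; move: est; rewrite !wprod_cons => /mulgI.
Qed.

(** Where reducedness first fails, reading from the right, the tail is reduced and the new letter
    [j] is a left descent of its product. The tail can be replaced by a reduced word starting with
    [j], and [dem j] applied twice is zero. *)
Lemma demw_nonreduced s p : valid_word l s -> size s != plen (wprod l s) -> demw s p = 0.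
Proof.
elim: s => [|j s IH] /=; first by rewrite /wprod big_nil plen1.
case/andP=> hj vs nr; have [rs|nrs] := eqVneq (size s) (plen (wprod l s)); last first.
  by rewrite /Defs.demw /= -/(demw _ _) IH // dem0.
move: nr; rewrite wprod_cons; case: (plen_sjl (wprod l s) hj) => [->|d _].
  by rewrite rs eqxx.
have [vr [er sr]] := hred (sj l j * wprod l s)%g.
have [c _ e] : proportional (demw s) (demw (j :: red (sj l j * wprod l s)%g)).
  apply: reduced_demw_eq => //=; rewrite ?hj ?wprod_cons ?er ?sjKl ?sr -?d //.
by rewrite /Defs.demw /= -/(demw _ _) e demZ /Defs.demw /= dem_dem // scaler0.
Qed.

End Matsumoto.

(** * Demazure operators on monomials *)

Section Monomials.
Variables (K : fieldType) (l : nat).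
Local Notation P := {mpoly K[l]}.
Local Notation X := (@X K l).
Implicit Types (c : K) (a b d : 'X_{1..l}) (p q r : P) (i k m n : 'I_l).

Lemma mnm_subK i a : (0 < a i)%N -> a = (U_(i) + (a - U_(i)))%MM.
Proof.
move=> hi; rewrite addmC submK //; apply/mnm_lepP => k; rewrite mnm1E.
by case: eqP => // <-.
Qed.

Lemma mcoeffUl m q d :
  (X m ** q)@_(U_(m) + d)%MM = (-1) ^+ (\sum_(j < l | (j < m)%N) d j)%N * q@_d.
Proof.
elim/mono_ind: q => [|p q e e'|c p e|a].
- by rewrite omul0r !mcoeff0 mulr0.
- by rewrite omulDr !mcoeffD e e' mulrDr.
- by rewrite omulZr !mcoeffZ e mulrCA.
rewrite omulUX mcoeffZ !mcoeffX eqm_add2l.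
by case: eqP => [->|]; rewrite ?mulr0.
Qed.

Lemma mcoeffUl_eq0 m q d : d m = 0%N -> (X m ** q)@_d = 0.
Proof.
move=> dm; elim/mono_ind: q => [|p q e e'|c p e|a].
- by rewrite omul0r !mcoeff0.
- by rewrite omulDr !mcoeffD e e' addr0.
- by rewrite omulZr !mcoeffZ e mulr0.
rewrite omulUX mcoeffZ !mcoeffX; case: eqP => [e|]; rewrite ?mulr0 //.
by move: dm; rewrite -e mnmDE mnm1E eqxx.
Qed.

Lemma mcoeffUl_neq0 m q d : (X m ** q)@_d != 0 ->
  (0 < d m)%N /\ q@_(d - U_(m))%MM != 0.
Proof.
move=> nz; have dm : (0 < d m)%N.
  by rewrite lt0n; apply: contra nz => /eqP/mcoeffUl_eq0 ->.
by split=> //; move: nz; rewrite {1}(mnm_subK dm) mcoeffUl mulf_eq0 signr_eq0.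
Qed.

Lemma mpolyXU m b :
  'X_[(U_(m) + b)%MM] = (-1) ^+ (\sum_(j < l | (j < m)%N) b j)%N *: (X m ** 'X_[b]).
Proof. by rewrite omulUX sgnK. Qed.

(** Induction on the degree: the other variables, and the product of [X i] and [X k], pass through
    [dem j] up to sign, and what remains is a power of one variable. The first clause bounds the
    monomials that occur; the second gives one that certainly occurs. *)
Lemma dem_mono j i k a : i = j :> nat -> k = j.+1 :> nat ->
  (forall d, (dem j ('X_[a] : P))@_d != 0 ->
     [/\ forall m, m != i -> m != k -> d m = a m,
         (d i < maxn (a i) (a k))%N, (d k < maxn (a i) (a k))%N
       & (mdeg d).+1 = mdeg a]) /\
  ((a k < a i)%N -> (dem j ('X_[a] : P))@_(a - U_(i))%MM != 0).
Proof.
move=> ei ek; have hj : (j.+1 < l)%N by rewrite -ek.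
have nik : i != k by rewrite -val_eqE /= ei ek; lia.
have nki : k != i by rewrite eq_sym.
have degS m b : mdeg (U_(m) + b)%MM = (mdeg b).+1 by rewrite mdegD mdeg1.
have UE m n b : (U_(m) + b)%MM n = ((m == n) + b n)%N by rewrite mnmDE mnm1E.
have [n] := ubnP (mdeg a); elim: n a => // n IH a; rewrite ltnS => an.
have scE e q d : (((-1) ^+ e *: q : P)@_d != 0) = (q@_d != 0).
  by rewrite mcoeffZ mulf_eq0 signr_eq0.
have [/existsP[m /and3P[am mi mk]]|] :=
    boolP [exists m : 'I_l, [&& (0 < a m)%N, m != i & m != k]].
  rewrite (mnm_subK am); set b := (a - U_(m))%MM.
  have [] := IH b; first by move: an; rewrite (mnm_subK am) -/b degS.
  move=> IH1 IH2.
  have dE : dem j ('X_[(U_(m) + b)%MM] : P) =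
      (-1) ^+ (\sum_(j < l | (j < m)%N) b j).+1 *: (X m ** dem j 'X_[b]).
    rewrite mpolyXU demZ demXl // (sxE _ _ ei ek) (dcoefE _ _ ei ek).
    by rewrite (negPf mi) (negPf mk) scale0r add0r omulNl exprS mulN1r scalerN scaleNr.
  rewrite dE !UE (negPf mi) (negPf mk) !add0n; split=> [d|lt].
    rewrite scE => /mcoeffUl_neq0[dm /IH1[h1 h2 h3 h4]].
    rewrite (mnm_subK dm) !UE (negPf mi) (negPf mk) !add0n; split => //.
      by move=> x xi xk; rewrite !UE h1.
    by rewrite !degS h4.
  rewrite scE; have bi : (0 < b i)%N by apply: leq_ltn_trans lt.
  have -> : (U_(m) + b - U_(i) = U_(m) + (b - U_(i)))%MM.
    by apply/mnmP=> x; rewrite !mnmBE !mnmDE !mnmBE !mnm1E; case: (eqVneq i x) => [<-|_]; lia.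
  by rewrite mcoeffUl mulf_eq0 signr_eq0 /=; apply: IH2.
rewrite negb_exists => /forallP oth.
have {oth} oth m : m != i -> m != k -> a m = 0%N.
  by move=> mi mk; move: (oth m); rewrite mi mk !andbT lt0n negbK => /eqP.
have [ai|ai] := posnP (a i); have [ak|ak] := posnP (a k).
- have -> : a = 0%MM.
    apply/mnmP => m; rewrite mnm0E; have [->//|mi] := eqVneq m i.
    by have [->//|mk] := eqVneq m k; apply: oth.
  by rewrite mpolyX0 dem1; split => [d|]; rewrite ?mcoeff0 ?eqxx // !mnm0E.
- rewrite (mnm_subK ak); set b := (a - U_(k))%MM.
  have [] := IH b; first by move: an; rewrite (mnm_subK ak) -/b degS.
  move=> IH1 _; have bi : b i = 0%N by rewrite /b mnmBE ai.
  have dE : dem j ('X_[(U_(k) + b)%MM] : P) =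
      (-1) ^+ (\sum_(j < l | (j < k)%N) b j) *: (- 'X_[b] + X i ** dem j 'X_[b]).
    rewrite mpolyXU demZ demXl // (sxE _ _ ei ek) (dcoefE _ _ ei ek).
    by rewrite (negPf nki) eqxx scaleN1r.
  rewrite !UE eqxx (negPf nki) bi add0n add1n max0n; split=> // d.
  rewrite dE scE mcoeffD mcoeffN => nz.
  have [e|ne] := eqVneq b d; first by rewrite -e bi degS; split=> // m mi mk; rewrite UE eq_sym (negPf mk).
  move: nz; rewrite mcoeffX (negPf ne) oppr0 add0r => /mcoeffUl_neq0[di /IH1[h1 h2 h3 h4]].
  move: h1 h2 h3 h4; set d' := (d - U_(i))%MM; rewrite (mnm_subK di) -/d' => h1 h2 h3 h4.
  rewrite !UE eqxx (negPf nik) degS; split => //; first 1 last.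
  + by move: h2; rewrite bi max0n; lia.
  + by move: h3; rewrite bi max0n; lia.
  + by rewrite degS h4.
  by move=> m mi mk; rewrite !UE h1 // eq_sym (negPf mi) eq_sym (negPf mk).
- rewrite (mnm_subK ai); set b := (a - U_(i))%MM.
  have [] := IH b; first by move: an; rewrite (mnm_subK ai) -/b degS.
  move=> IH1 _; have bk : b k = 0%N by rewrite /b mnmBE ak.
  have dE : dem j ('X_[(U_(i) + b)%MM] : P) =
      (-1) ^+ (\sum_(j < l | (j < i)%N) b j) *: ('X_[b] + X k ** dem j 'X_[b]).
    rewrite mpolyXU demZ demXl // (sxE _ _ ei ek) (dcoefE _ _ ei ek).
    by rewrite eqxx scale1r.
  (* The coefficient at [b] comes only from ['X_[b]]: the other term is divisible by [X k], and
     [b k = 0]. *)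
  rewrite !UE eqxx (negPf nik) bk add0n add1n maxn0 dE; split=> [d|_]; last first.
    by rewrite addmC addmK scE mcoeffD mcoeffX eqxx mcoeffUl_eq0 // addr0 oner_neq0.
  rewrite scE mcoeffD => nz.
  have [e|ne] := eqVneq b d; first by rewrite -e bk degS; split=> // m mi mk; rewrite UE eq_sym (negPf mi).
  move: nz; rewrite mcoeffX (negPf ne) add0r => /mcoeffUl_neq0[dk /IH1[h1 h2 h3 h4]].
  move: h1 h2 h3 h4; set d' := (d - U_(k))%MM; rewrite (mnm_subK dk) -/d' => h1 h2 h3 h4.
  rewrite !UE eqxx (negPf nki) degS; split => //; first 1 last.
  + by move: h2; rewrite bk maxn0; lia.
  + by move: h3; rewrite bk maxn0; lia.
  + by rewrite degS h4.
  by move=> m mi mk; rewrite !UE h1 // eq_sym (negPf mk) eq_sym (negPf mi).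
have bk' : (0 < (a - U_(i))%MM k)%N by rewrite mnmBE mnm1E (negPf nik) subn0.
rewrite (mnm_subK ai) (mnm_subK bk'); set b := (a - U_(i) - U_(k))%MM.
have [] := IH b; first by move: an; rewrite (mnm_subK ai) (mnm_subK bk') -/b !degS; lia.
move=> IH1 IH2.
(* The terms in which the operator hits [X i] or [X k] cancel. *)
have [e dE] : exists e, dem j ('X_[(U_(i) + (U_(k) + b))%MM] : P) =
    (-1) ^+ e *: (X k ** (X i ** dem j 'X_[b])).
  exists (\sum_(j < l | (j < i)%N) (U_(k) + b)%MM j + \sum_(j < l | (j < k)%N) b j)%N.
  rewrite mpolyXU (mpolyXU k) omulZr !demZ scalerA -exprD demXl // demXl //.
  rewrite !(sxE _ _ ei ek) !(dcoefE _ _ ei ek) !eqxx (negPf nki) scale1r scaleN1r.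
  by rewrite omulDr omulNr addrA addrN add0r.
rewrite dE !UE !eqxx (negPf nki) (negPf nik) !add0n !add1n; split=> [d|lt].
  rewrite scE => /mcoeffUl_neq0[dk /mcoeffUl_neq0[di /IH1]].
  set d' := (d - U_(k) - U_(i))%MM; case=> h1 h2 h3 h4.
  rewrite (mnm_subK dk) (mnm_subK di) -/d' !UE !eqxx (negPf nki) (negPf nik) !degS; split.
  - by move=> m mi mk; rewrite !UE h1 //; lia.
  - by rewrite add0n maxnSS.
  - by rewrite add0n maxnSS.
  by rewrite h4.
have bi : (0 < b i)%N by lia.
rewrite scE addmC addmK mcoeffUl mulf_eq0 signr_eq0 /= {1}(mnm_subK bi).
by rewrite mcoeffUl mulf_eq0 signr_eq0 /=; apply: IH2; lia.
Qed.

End Monomials.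

(** * Odd Schubert polynomials *)

Section Degree.
Variables (K : fieldType) (l : nat).
Local Notation P := {mpoly K[l]}.
Local Notation X := (@X K l).
Implicit Types (c : K) (a b d : 'X_{1..l}) (p q r : P) (i k : 'I_l) (m n : nat) (s t : seq nat).

Lemma mext_mcoeff (F : 'X_{1..l} -> P) p d : (mext F p)@_d != 0 ->
  exists2 a, p@_a != 0 & (F a)@_d != 0.
Proof.
move=> nz; have [/hasP[a ha na]|/hasPn h] :=
    boolP (has (fun a => (F a)@_d != 0) (msupp p)).
  by exists a => //; rewrite -mcoeff_msupp.
case/eqP: nz; rewrite /mext (big_morph _ (mcoeffD d) (mcoeff0 _ d)) big_seq big1 // => a ha /=.
by rewrite mcoeffZ; move/h: ha; rewrite negbK => /eqP->; rewrite mulr0.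
Qed.

Lemma dem_mcoeff j p d : (dem j p)@_d != 0 ->
  exists2 a, p@_a != 0 & (dem j ('X_[a] : P))@_d != 0.
Proof.
case/mext_mcoeff => a ha na; exists a => //.
by rewrite /dem -/(mext _ _) mextX.
Qed.

Definition hdeg n p := forall a, p@_a != 0 -> mdeg a = n.

Lemma hdeg_dem j n p : (j.+1 < l)%N -> hdeg n p -> hdeg n.-1 (dem j p).
Proof.
move=> /ord_pair[i [k [ei ek _ _]]] hp d /dem_mcoeff[a /hp <-].
by case: (dem_mono K a ei ek) => h _ /h[_ _ _ <-].
Qed.

Lemma hdeg_demw n s p : valid_word l s -> hdeg n p -> hdeg (n - size s) (demw s p).
Proof.
move=> + hp; elim: s => [|j s IH] /=; first by rewrite subn0.
by case/andP=> hj /IH; rewrite subnS; apply: hdeg_dem.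
Qed.

Lemma demw0 s : demw s (0 : P) = 0.
Proof. by elim: s => //= j s ->; apply: dem0. Qed.

Lemma demwD s p q : demw s (p + q) = demw s p + demw s q.
Proof. by elim: s => //= j s ->; rewrite demD. Qed.

Lemma demwZ s c p : demw s (c *: p) = c *: demw s p.
Proof. by elim: s => //= j s ->; rewrite demZ. Qed.

Lemma demwB s p q : demw s (p - q) = demw s p - demw s q.
Proof. by rewrite -scaleN1r demwD demwZ scaleN1r. Qed.

Lemma demw_sum (I : Type) (r : seq I) (Q : pred I) (F : I -> P) s :
  demw s (\sum_(i <- r | Q i) F i) = \sum_(i <- r | Q i) demw s (F i).
Proof. exact: (big_morph _ (demwD s) (demw0 s)). Qed.

Lemma demw_cat s t p : demw (s ++ t) p = demw s (demw t p).
Proof. exact: foldr_cat. Qed.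

Lemma hdeg0P p : hdeg 0 p -> p = p@_0%MM *: 1.
Proof.
move=> hp; apply/mpolyP => a; rewrite mcoeffZ mcoeff1.
have [->|na] := eqVneq a 0%MM; first by rewrite mulr1.
rewrite mulr0; apply/eqP; apply: contraNT na => /hp/eqP.
by rewrite mdeg_eq0.
Qed.

Lemma hdegZ n c p : hdeg n p -> hdeg n (c *: p).
Proof. by move=> hp a; rewrite mcoeffZ mulf_eq0 negb_or => /andP[_ /hp]. Qed.

Lemma hdegX a : hdeg (mdeg a) ('X_[a] : P).
Proof. by move=> d; rewrite mcoeffX; have [->//|_] := eqVneq a d; rewrite eqxx. Qed.

Lemma hdeg1 : hdeg 0 (1 : P).
Proof.
by move=> a; rewrite mcoeff1; have [->|_] := eqVneq a 0%MM; rewrite ?mdeg0 // eqxx.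
Qed.

Lemma hdegU i : hdeg 1 (X i).
Proof. by rewrite -(mdeg1 i); apply: hdegX. Qed.

Lemma hdegM n m p q : hdeg n p -> hdeg m q -> hdeg (n + m) (p ** q).
Proof.
move=> hp hq a; rewrite omulE => /mext_mcoeff[b /hp <-].
case/mext_mcoeff => d /hq <-; rewrite -mdegD.
by move: a; apply/hdegZ/hdegX.
Qed.

Lemma mdeg_pair i k a : i != k ->
  mdeg a = (a i + a k + \sum_(m < l | (m != i) && (m != k)) a m)%N.
Proof. by move=> nik; rewrite mdegE (bigD1 i) //= (bigD1 k) 1?eq_sym //= addnA. Qed.

(** By [dem_mono] the new exponents at [i] and [k] are at most [a k], while the degree forces their
    sum to be [2 * a k]; only one monomial remains. *)
Lemma dem_step j i k a : i = j :> nat -> k = j.+1 :> nat -> a i = (a k).+1 ->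
  exists2 c, c != 0 & dem j ('X_[a] : P) = c *: 'X_[(a - U_(i))%MM].
Proof.
move=> ei ek ea; have [h1 h2] := dem_mono K a ei ek.
have nik : i != k by rewrite -val_eqE /= ei ek; lia.
exists ((dem j ('X_[a] : P))@_(a - U_(i))%MM); first by apply: h2; lia.
apply/mpolyP => d; rewrite mcoeffZ mcoeffX.
have [->|nd] := eqVneq; first by rewrite mulr1.
rewrite mulr0; apply/eqP; apply: contraNT nd => /h1[e di dk].
rewrite (mdeg_pair d nik) (mdeg_pair a nik) => ed.
have es : (\sum_(m < l | (m != i) && (m != k)) d m =
           \sum_(m < l | (m != i) && (m != k)) a m)%N.
  by apply: eq_bigr => m /andP[mi mk]; apply: e.
rewrite es in ed; apply/eqP/mnmP => m; rewrite mnmBE mnm1E.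
have [<-|mi] := eqVneq i m; first lia.
have [<-|mk] := eqVneq k m; first lia.
by rewrite e 1?eq_sym // subn0.
Qed.

(** The exponent of the staircase monomial in the first [n] variables; truncated subtraction sends
    the others to zero. *)
Definition stair n : 'X_{1..l} := [multinom (n.-1 - i)%N | i < l].

Definition reach a b := exists s c,
  [/\ valid_word l s, c != 0 & demw s ('X_[a] : P) = c *: 'X_[b]].

Lemma reach_refl a : reach a a.
Proof. by exists [::], 1; rewrite oner_neq0 scale1r. Qed.

Lemma reach_trans a b d : reach a b -> reach b d -> reach a d.
Proof.
case=> s [c [vs nc es]] [t [c' [vt nc' et]]]; exists (t ++ s), (c * c').
by rewrite /valid_word all_cat mulf_neq0 // demw_cat es demwZ et scalerA; split => //; apply/andP.
Qed.

Lemma reach_stairS n : (n < l)%N -> reach (stair n.+1) (stair n).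
Proof.
(* In [A x] the first [x] exponents are already lowered. [dem x] comes next, as the exponent at [x]
   exceeds its right neighbour by one. *)
move=> nl; pose A x := [multinom (if i < x then n.-1 - i else n - i)%N | i < l] : 'X_{1..l}.
have -> : stair n.+1 = A 0%N by apply/mnmP => i; rewrite !mnmE.
have -> : stair n = A n by apply/mnmP => i; rewrite !mnmE; case: ltnP => //; lia.
suff gen x : (x <= n)%N -> reach (A 0%N) (A x) by apply: gen.
elim: x => [|x IH] tn; first exact: reach_refl.
apply: reach_trans (IH (ltnW tn)) _.
have ht : (x.+1 < l)%N by lia.
have [i [k [ei ek _ _]]] := ord_pair ht.
have [] := dem_step (a := A x) ei ek; first by rewrite !mnmE ei ek ltnn ltnNge leqnSn /=; lia.
move=> c nc e; exists [:: x], c; split; rewrite /valid_word /= ?andbT // e.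
congr (_ *: 'X_[_]); apply/mnmP => m; rewrite mnmBE mnm1E !mnmE -val_eqE /= ei.
by do 2?case: ltnP => ?; case: eqP => /=; lia.
Qed.

Lemma reach_stair0 : reach (stair l) 0%MM.
Proof.
have -> : 0%MM = stair 0 by apply/mnmP => i; rewrite !mnmE.
suff gen n : (n <= l)%N -> reach (stair l) (stair (l - n)) by rewrite -(subnn l); apply: gen.
elim: n => [|n IH] nl; first by rewrite subn0; apply: reach_refl.
apply: reach_trans (IH (ltnW nl)) _.
by rewrite (_ : l - n = (l - n.+1).+1)%N; [apply: reach_stairS|]; lia.
Qed.

Lemma mdeg_stair : mdeg (stair l) = maxlen l.
Proof. by rewrite mdegE; apply: eq_bigr => i _; rewrite mnmE; lia. Qed.

Lemma opowX_mul i n b : exists2 c, c != 0 &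
  opow (X i) n ** ('X_[b] : P) = c *: 'X_[(U_(i) *+ n + b)%MM].
Proof.
elim: n => [|n [c nc e]].
  by exists 1; rewrite ?oner_neq0 // /opow /= omul1l scale1r mulm0n add0m.
rewrite /opow /= -omulA -/(opow _ _) e omulZr omulUX scalerA mulmS addmA.
by eexists; last reflexivity; rewrite mulf_neq0 // signr_eq0.
Qed.

Lemma xi_stair : exists2 c, c != 0 & xi K l = c *: 'X_[stair l].
Proof.
have -> : stair l = (\sum_(i <- rev (enum 'I_l)) U_(i) *+ (l.-1 - i))%MM.
  apply/mnmP => k; rewrite mnmE mnm_sumE (perm_big (enum 'I_l)) ?perm_rev //=.
  rewrite big_enum (bigD1 k) //= big1 ?addn0 => [|i nik].
    by rewrite mulmnE mnm1E eqxx mul1n.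
  by rewrite mulmnE mnm1E (negPf nik).
rewrite /xi; elim: (rev _) => [|i s [c nc e]] /=.
  by exists 1; rewrite ?oner_neq0 // big_nil mpolyX0 scale1r.
have [c' nc' e'] := opowX_mul i (l.-1 - i) (\sum_(i <- s) U_(i) *+ (l.-1 - i))%MM.
by exists (c * c'); rewrite ?mulf_neq0 // e omulZr e' scalerA big_cons.
Qed.

Lemma hdeg_xi : hdeg (maxlen l) (xi K l).
Proof. by have [c _ ->] := xi_stair; apply: hdegZ; rewrite -mdeg_stair; apply: hdegX. Qed.

End Degree.

(** * Triangularity of [demw] on the odd Schubert polynomials *)

Section Schubert.
Variables (K : fieldType) (l : nat) (red : 'S_l -> seq nat).
Hypothesis hred : forall w, reduced_word w (red w).
Local Notation P := {mpoly K[l]}.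
Local Notation demw := (@demw K l).
Local Notation pw := (oschub K red).
Local Notation N := (maxlen l).
Implicit Types (c : K) (p q r : P) (u w : 'S_l) (s t : seq nat) (j : nat).

Lemma plen0 w : plen w = 0%N -> w = 1%g.
Proof.
have [_ [ew sw]] := hred w => w0; move: sw; rewrite w0 => /size0nil es.
by rewrite -ew es /wprod big_nil.
Qed.

Lemma plen_max w : plen w = N -> w = wlong l.
Proof.
have key u : plen u = N -> (u * wlong l = 1)%g.
  by move=> eu; apply: plen0; have := plen_wlong u; rewrite eu; lia.
have /key/(canRL (mulgK _)) e : plen (wlong l) = N.
  by have := plen_wlong (1%g : 'S_l); rewrite mul1g plen1 addn0.
by move/key/(canRL (mulgK _)) => ->; rewrite [RHS]e.
Qed.

Lemma plen_wlong1 : plen (wlong l) = N.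
Proof. by have := plen_wlong (1%g : 'S_l); rewrite mul1g plen1 addn0. Qed.

Lemma demw_top s : valid_word l s -> (N <= size s)%N -> demw s (xi K l) != 0 ->
  wprod l s = wlong l /\ size s = N.
Proof.
move=> vs Ns nz; have es : size s = plen (wprod l s).
  by apply/eqP; apply: contraR nz => /(demw_nonreduced hred) ->.
have := plen_le (wprod l s); rewrite -es => sN.
have esN : size s = N by lia.
by split=> //; apply: plen_max; rewrite -es.
Qed.

(** The word that lowers the staircase to a scalar has length at least [N] by degree and does not
    kill [xi]; [demw_top] then identifies it as a reduced word of [wlong l] without computing its
    product. *)
Lemma demw_wlong : exists2 c, c != 0 & demw (red (wlong l)) (xi K l) = c *: 1.
Proof.
have [c nc exi] := xi_stair K l; have [s [c' [vs nc' es]]] := reach_stair0 K l.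
have es1 : demw s (xi K l) = (c * c') *: 1 by rewrite exi demwZ es scalerA mpolyX0.
have nz : demw s (xi K l) != 0.
  by rewrite es1 scaler_eq0 negb_or mulf_neq0 //= oner_neq0.
have Ns : (N <= size s)%N.
  have /(_ 0%MM) := hdeg_demw vs (@hdeg_xi K l).
  by rewrite es1 mcoeffZ mcoeff1 eqxx mulr1 mulf_neq0 // mdeg0 => /(_ isT); lia.
have [ew esN] := demw_top vs Ns nz; have [vr [er sr]] := hred (wlong l).
have [] := reduced_demw_eq K hred vr vs; rewrite ?er ?ew ?esN ?plen_wlong1 ?sr ?plen_wlong1 //.
by move=> d nd ed; exists (d * (c * c')); rewrite ?mulf_neq0 // ed es1 scalerA.
Qed.

Lemma plen_dual w : (plen (w^-1 * wlong l)%g + plen w = N)%N.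
Proof. by rewrite -[in X in (_ + X)%N]plenV plen_wlong. Qed.

(** Followed by the word that defines [pw w], [s] becomes a word of length at least [N] that does
    not kill [xi], so the whole product is [wlong l]. This triangularity drives both spanning and
    independence. *)
Lemma demw_oschub_neq0 s w : valid_word l s -> (plen w <= size s)%N ->
  demw s (pw w) != 0 -> wprod l s = w.
Proof.
move=> vs ws; rewrite /oschub -demw_cat; have [vr [er sr]] := hred (w^-1 * wlong l)%g.
case/demw_top => [||e _]; first by rewrite /valid_word all_cat; apply/andP.
  by rewrite size_cat sr -(plen_dual w) addnC leq_add2r.
move: e; rewrite wprod_cat er mulgA -[RHS]mul1g => /mulIg e.
by rewrite -[LHS](mulgKV w) e mul1g.
Qed.

Lemma demw_oschub w : exists2 c, c != 0 & demw (red w) (pw w) = c *: 1.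
Proof.
rewrite /oschub -demw_cat; have [vr [er sr]] := hred (w^-1 * wlong l)%g.
have [vw [ew sw]] := hred w; have [vl [el sl]] := hred (wlong l).
have [c nc e] := demw_wlong.
have [] := reduced_demw_eq K hred (s := red w ++ red (w^-1 * wlong l)%g) (t := red (wlong l)).
- by rewrite /valid_word all_cat; apply/andP.
- by [].
- by rewrite wprod_cat ew er el mulKVg.
- by rewrite wprod_cat ew er mulKVg size_cat sr sw addnC plen_dual plen_wlong1.
- by rewrite el sl.
by move=> d nd ed; exists (d * c); rewrite ?mulf_neq0 // ed e scalerA.
Qed.

Lemma hdeg_oschub w : hdeg (plen w) (pw w).
Proof.
have [vr [er sr]] := hred (w^-1 * wlong l)%g.
have := hdeg_demw vr (@hdeg_xi K l); rewrite sr.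
by rewrite -(plen_dual w) addKn.
Qed.

(** By [plen_dual], a right ascent of [w] at [j] is a left descent of [w^-1 * wlong l], so prefixing
    [j] to a word of the latter gives a non-reduced word. *)
Lemma dem_oschub_asc j w : (j.+1 < l)%N -> (plen w < plen (w * sj l j)%g)%N ->
  dem j (pw w) = 0.
Proof.
move=> hj asc; have [vr [er sr]] := hred (w^-1 * wlong l)%g.
change (demw (j :: red (w^-1 * wlong l)%g) (xi K l) = 0).
apply: (demw_nonreduced hred) => /=; first by rewrite hj.
rewrite wprod_cons er sr mulgA -{1}(sjV l j) -invMg.
have e1 := plen_dual w; have e2 := plen_dual (w * sj l j)%g.
by apply/eqP => e3; rewrite -e3 in e2; move: asc e1 e2;
  set x := plen _; set y := plen _; set z := plen _; lia.
Qed.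

End Schubert.

(** * The common kernel is generated by elementary symmetric polynomials *)

Section Invariants.
Variables (K : fieldType) (l : nat).
Local Notation P := {mpoly K[l]}.
Local Notation X := (@X K l).
Implicit Types (c : K) (f g h p q r : P) (i m : 'I_l) (s t : seq 'I_l) (j k n : nat).

(** The odd elementary symmetric polynomial of degree [n] in the variables listed in [s]. Allowing
    sublists makes recursion on the number of variables possible. *)
Fixpoint esymw s n : P :=
  match s with
  | [::] => (n == 0%N)%:R
  | i :: s' => esymw s' n + (if n is n'.+1 then X i ** esymw s' n' else 0)
  end.

Lemma esymw0 s : esymw s 0 = 1.
Proof. by elim: s => //= i s ->; rewrite addr0. Qed.

Lemma esymw_gt s n : (size s < n)%N -> esymw s n = 0.
Proof.
elim: s n => [|i s IH] [|n] //=; rewrite ltnS => lt.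
by rewrite !IH // ?omul0r ?addr0 // ltnW.
Qed.

Lemma sum_subsets_esymw s n : uniq s ->
  \sum_(S : {set 'I_l} | (S \subset s) && (#|S| == n)) prodw K [seq i <- s | i \in S] =
  esymw s n.
Proof.
elim: s n => [|i s IH] n /=.
  move=> _; have sub0 (S : {set 'I_l}) : (S \subset [::]) = (S == set0).
    by rewrite -subset0; apply: eq_subset_r => x; rewrite inE.
  case: n => [|n] /=.
    rewrite (big_pred1 set0) // => S; rewrite sub0.
    by have [->|/negPf ne] := eqVneq S set0; rewrite /= ?cards0 ?eqxx ?ne.
  rewrite big_pred0 // => S; rewrite sub0.
  by have [->|/negPf ne] := eqVneq S set0; rewrite /= ?cards0 ?eqxx ?ne.
case/andP=> nis us; rewrite (bigID (fun S : {set 'I_l} => i \in S)) /= addrC; congr (_ + _).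
  rewrite -IH //; apply: eq_big => [S|S /andP[_ /negPf->]] //.
  rewrite -andbA andbC -andbA andbC -andbA; case: (boolP (#|S| == n)) => //= _; rewrite ?andbT ?andbF //.
  apply/andP/idP => [[niS /subsetP sub]|/subsetP sub].
    apply/subsetP => x xS; move: (sub x xS); rewrite inE => /orP[/eqP e|//].
    by rewrite -e xS in niS.
  split; last by apply/subsetP => x /sub; rewrite inE orbC => ->.
  by apply: contra nis => /sub.
(* Subsets containing [i] correspond to subsets [T] of the rest with one element fewer. *)
rewrite (reindex_onto (fun T => i |: T) (fun S => S :\ i)) /=; last first.
  by move=> S /andP[_]; apply: setD1K.
have cond (T : {set 'I_l}) : ((i |: T \subset i :: s) && (#|i |: T| == n) && (i \in i |: T) &&
    ((i |: T) :\ i == T)) = (if n is n'.+1 then (T \subset s) && (#|T| == n') else false).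
  rewrite setU11 andbT; have -> : ((i |: T) :\ i == T) = (i \notin T).
    by apply/eqP/idP => [<-|/setU1K //]; rewrite !inE eqxx.
  have [iT|niT] := boolP (i \in T).
    rewrite andbF; case: (n) => // n'; apply/esym/negbTE; rewrite negb_and.
    by rewrite (contra _ nis) // => /subsetP; apply.
  rewrite andbT cardsU1 niT add1n; case: (n) => [|n']; rewrite ?andbF // eqSS.
  congr andb; apply/subsetP/subsetP => sub x; last first.
    by rewrite !inE => /orP[->//|/sub->]; rewrite orbT.
  move=> xT; have := sub x; rewrite !inE xT orbT => /(_ isT) /orP[/eqP e|//].
  by rewrite -e xT in niT.
rewrite (eq_bigl _ _ cond); case: n {cond} => [|n]; first by rewrite big_pred0.
rewrite -IH // omul_sumr; apply: eq_bigr => T /andP[/subsetP sub _].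
rewrite setU11 /=; congr (_ ** prodw _ _); apply: eq_in_filter => x xs.
by rewrite !inE; case: eqP => // e; rewrite -e xs in nis.
Qed.

Lemma esymE n : Defs.esym K l n = esymw (enum 'I_l) n.
Proof.
rewrite -sum_subsets_esymw ?enum_uniq // /Defs.esym; apply: eq_big => [S|S _].
  rewrite (_ : S \subset _) //; apply/subsetP => x _; exact: mem_enum.
by congr prodw; rewrite {1}/enum_mem -enumT.
Qed.

Lemma dem_esymw_notin j s n : (j.+1 < l)%N ->
  (forall i, i \in s -> (i != j :> nat) && (i != j.+1 :> nat)) -> dem j (esymw s n) = 0.
Proof.
move=> hj; elim: s n => [|i s IH] n hs /=.
  by rewrite -scaler_nat demZ dem1 scaler0.
have {}IH k : dem j (esymw s k) = 0 by apply: IH => m ms; apply: hs; rewrite inE ms orbT.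
rewrite demD IH add0r; case: n => [|n]; first exact: dem0.
have /andP[/negPf h1 /negPf h2] := hs i (mem_head _ _).
by rewrite demXl // IH omul0r /dcoef h1 h2 subrr scale0r addr0.
Qed.

(** [i] and [k] are consecutive in the enumeration, so [X i] and [X k] enter only through
    [X i + X k] and [X i ** X k], both killed by [dem j]; the letters in front pass through with a
    sign. *)
Lemma dem_esym j n : (j.+1 < l)%N -> dem j (Defs.esym K l n) = 0.
Proof.
move=> hj; rewrite esymE; have [i [k [ei ek nki nik]]] := ord_pair hj.
have e : enum 'I_l = take j (enum 'I_l) ++ [:: i, k & drop j.+2 (enum 'I_l)].
  rewrite -{1}(cat_take_drop j (enum 'I_l)); congr (_ ++ _).
  have n1 : nth i (enum 'I_l) j = i by rewrite -ei nth_ord_enum.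
  have n2 : nth i (enum 'I_l) j.+1 = k by have := nth_ord_enum i k; rewrite ek.
  rewrite (drop_nth i) ?size_enum_ord; last lia.
  by rewrite (drop_nth i (n := j.+1)) ?size_enum_ord // n1 n2.
have := enum_uniq 'I_l; rewrite {}e cat_uniq /= => /and3P[_ h /and3P[h1 h2 _]].
move: h; rewrite !negb_or => /and3P[h3 h4 _]; move: h1; rewrite inE negb_or => /andP[_ h1].
have dt n' : dem j (esymw (drop j.+2 (enum 'I_l)) n') = 0.
  apply: dem_esymw_notin => // m hm; rewrite -ek -ei !val_eqE.
  by apply/andP; split; apply/eqP => e; rewrite -e hm in h1 h2.
move: h3 h4 dt; move: (take _ _) (drop _ _) => s t.
elim: s n => [|m s IH] n /=; last first.
  rewrite !inE !negb_or => /andP[nm h3] /andP[nm' h4] dt.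
  have {}IH n' := IH n' h3 h4 dt; rewrite demD IH add0r; case: n => [|n]; first exact: dem0.
  by rewrite demXl // IH omul0r (dcoefE K _ ei ek) eq_sym (negPf nm) eq_sym (negPf nm') scale0r addr0.
move=> _ _ dt; rewrite !demD dt add0r.
case: n => [|n]; first by rewrite !dem0 addr0.
rewrite !demXl // demD dt !(sxE K _ ei ek) !(dcoefE K _ ei ek) !eqxx (negPf nki).
rewrite omul0r !addr0 add0r scale1r scaleN1r addrA addKr.
case: n => [|n]; first by rewrite dem0 omul0r addr0.
rewrite demXl // dt omul0r addr0 (dcoefE K _ ei ek) eqxx (negPf nki).
by rewrite scaleN1r omulNr addrN.
Qed.

Definition invariant f := forall j, (j.+1 < l)%N -> dem j f = 0.

Lemma OSym_invariant f : OSym f -> invariant f.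
Proof.
move=> hf j hj; elim: hf => [p [n ->]||p q _ hp _ hq|c p _ hp|p q _ hp _ hq].
- exact: dem_esym.
- exact: dem1.
- by rewrite demD hp hq addr0.
- by rewrite demZ hp scaler0.
by rewrite demM // hp hq omul0l omul0r addr0.
Qed.

Lemma demwMr (w : seq nat) p f : valid_word l w -> invariant f ->
  demw w (p ** f) = demw w p ** f.
Proof.
move=> + hf; elim: w => //= j w IH /andP[hj /IH ->].
by rewrite demM // hf // omul0r addr0.
Qed.

(* The right OSym-span of the monomials in the variables of the list whose exponent at each
   variable is less than [l] minus the number of variables listed after it. *)
Fixpoint staircase s f : Prop :=
  match s with
  | [::] => OSym f
  | i :: s' => exists2 g : nat -> P, forall k, staircase s' (g k) &
      f = \sum_(k < l - size s') opow (X i) k ** g k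
  end.

Lemma staircaseZ s c f : staircase s f -> staircase s (c *: f).
Proof.
elim: s f => [|i s IH] f /=; first exact: gen_scale.
case=> g hg ->; exists (fun k => c *: g k) => [k|]; first exact: IH.
by rewrite scaler_sumr; apply: eq_bigr => k _; rewrite omulZr.
Qed.

Lemma staircaseD s f g : staircase s f -> staircase s g -> staircase s (f + g).
Proof.
elim: s f g => [|i s IH] f g /=; first exact: gen_add.
case=> f' hf -> [g' hg ->]; exists (fun k => f' k + g' k) => [k|]; first exact: IH.
by rewrite -big_split; apply: eq_bigr => k _; rewrite omulDr.
Qed.

Lemma staircase0 s : staircase s 0.
Proof.
elim: s => [|i s IH]; first by rewrite -(scale0r 1); apply/gen_scale/gen_1.
by exists (fun=> 0) => //; rewrite big1 // => k _; rewrite omul0r.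
Qed.

Lemma staircase_sum (I : Type) (r : seq I) (Q : pred I) (F : I -> P) s :
  (forall x, Q x -> staircase s (F x)) -> staircase s (\sum_(x <- r | Q x) F x).
Proof. by move=> h; elim/big_ind: _ => //; [apply: staircase0|apply: staircaseD]. Qed.

Lemma staircaseB s f g : staircase s f -> staircase s g -> staircase s (f - g).
Proof. by move=> hf hg; rewrite -scaleN1r; apply/staircaseD/staircaseZ. Qed.

Lemma staircase_pow i s k h : (k < l - size s)%N -> staircase s h ->
  staircase (i :: s) (opow (X i) k ** h).
Proof.
move=> kn hh; exists (fun k' => if k' == k then h else 0) => [k'|].
  by case: eqP => // _; apply: staircase0.
rewrite (bigD1 (Ordinal kn)) //= eqxx big1 ?addr0 // => k'; rewrite -val_eqE /= => /negPf->.
by rewrite omul0r.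
Qed.

Lemma XopowC m i k : m != i ->
  exists e : nat, X m ** opow (X i) k = (-1) ^+ e *: (opow (X i) k ** X m).
Proof.
move=> nmi; elim: k => [|k [e IH]].
  by exists 0%N; rewrite omul1l omul1r scale1r.
exists e.+1; rewrite /opow /= -/(opow _ _) omulA omul_XC // omulNl -omulA IH omulZr omulA.
by rewrite exprS mulN1r scaleNr.
Qed.

Lemma esymw_XC i t n : i \notin t ->
  esymw t n ** X i = (-1) ^+ n *: (X i ** esymw t n).
Proof.
elim: t n => [|m t IH] n /=.
  by move=> _; case: n => [|n]; rewrite /= ?omul1l ?omul1r ?scale1r // omul0l omul0r scaler0.
rewrite inE negb_or => /andP[nim /IH{}IH]; rewrite omulDl omulDr scalerDr IH; congr (_ + _).
case: n => [|n]; first by rewrite omul0l omul0r scaler0.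
by rewrite -omulA IH omulZr omulA omul_XC 1?eq_sym // omulNl omulA exprS mulN1r scaleNr scalerN.
Qed.

Lemma esymw_powC i t n k : i \notin t ->
  exists e : nat, esymw t n ** opow (X i) k = (-1) ^+ e *: (opow (X i) k ** esymw t n).
Proof.
move=> nit; elim: k => [|k [e IH]].
  by exists 0%N; rewrite omul1l omul1r scale1r.
exists (n + e)%N; rewrite /opow /= -/(opow _ _) omulA esymw_XC // omulZl -!omulA IH omulZr.
by rewrite scalerA exprD.
Qed.

(** [s] lists an initial segment of the variables in reverse, and [t] the others. Closure under the
    elementary polynomials in [t] is carried along because it reduces the high powers of the next
    variable. *)
Lemma staircase_closed s t : catrev s t = enum 'I_l ->
  (forall i f, i \in s -> staircase s f -> staircase s (X i ** f)) /\
  (forall n f, staircase s f -> staircase s (esymw t n ** f)).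
Proof.
elim: s t => [|i s IH] t e.
  split=> // n f hf; apply: gen_mul hf; apply: gen_in; exists n.
  by rewrite esymE -e.
have {IH} [IHX IHE] := IH (i :: t) e.
have [nis nit] : i \notin s /\ i \notin t.
  have := enum_uniq 'I_l; rewrite -e /= catrevE uniq_catC /= mem_cat mem_rev negb_or.
  by case/andP=> /andP[].
have sz : (l - size s = (size t).+1)%N.
  by have := size_enum_ord l; rewrite -e catrevE size_cat size_rev /=; lia.
(* The recursion for [i :: t], solved for the polynomial in the fewer variables [t]. *)
have E'S n h : esymw t n.+1 ** h = esymw (i :: t) n.+1 ** h - X i ** (esymw t n ** h).
  by rewrite /= omulDl omulA addrK.
have low k h : (k < (size t).+1)%N -> staircase s h -> staircase (i :: s) (opow (X i) k ** h).
  by rewrite -sz; apply: staircase_pow.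
(* Powers of [X i] are traded for degrees of [esymw t]: at [a = 0] the degree is too large and
   [esymw t] vanishes, and [a = (size t).+1] is the first power of [X i] that is too high. *)
have top a h : (a <= (size t).+1)%N -> staircase s h ->
    staircase (i :: s) (opow (X i) a ** (esymw t ((size t).+1 - a) ** h)).
  elim: a => [|a IH] an hh; first by rewrite subn0 esymw_gt // omul0l omul0r; apply: staircase0.
  have := E'S (size t - a)%N h; rewrite -subSn // => E'.
  have -> : opow (X i) a.+1 ** (esymw t ((size t).+1 - a.+1) ** h) =
      opow (X i) a ** (esymw (i :: t) ((size t).+1 - a) ** h) -
      opow (X i) a ** (esymw t ((size t).+1 - a) ** h).
    rewrite E' omulBr opprB addrC subrK subSS [RHS]omulA; congr (_ ** _).
    by elim: (a) => [|b IHb]; [rewrite /opow /= omul1l omul1r | rewrite -[LHS]/(X i ** opow (X i) b.+1) {1}IHb omulA].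
  by apply: staircaseB; [apply: low => //; apply: IHE|apply: IH => //; apply: ltnW].
have closedX f : staircase (i :: s) f -> staircase (i :: s) (X i ** f).
  case=> g hg ->; rewrite omul_sumr; apply: staircase_sum => -[k kn] _ /=.
  rewrite omulA (_ : X i ** opow (X i) k = opow (X i) k.+1) //.
  have [lt|ge] := ltnP k.+1 (size t).+1; first exact: low (hg k).
  have -> : k.+1 = (size t).+1 by lia.
  by have := top _ _ (leqnn _) (hg k); rewrite subnn esymw0 omul1l.
have closedXn k f : staircase (i :: s) f -> staircase (i :: s) (opow (X i) k ** f).
  move=> hf; elim: k => [|k IH]; first by rewrite omul1l.
  by rewrite /opow /= -/(opow _ _) -omulA; apply: closedX.
split=> [m f|n f].
  rewrite inE => /orP[/eqP->|ms]; first exact: closedX.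
  have nmi : m != i by apply: contraNneq nis => <-.
  case=> g hg ->; rewrite omul_sumr; apply: staircase_sum => k _.
  have [a ea] := XopowC k nmi; rewrite omulA ea omulZl -omulA; apply: staircaseZ.
  by apply: staircase_pow => //; apply: IHX ms (hg k).
case=> g hg ->; rewrite omul_sumr; apply: staircase_sum => k _.
have [a ea] := esymw_powC n k nit; rewrite omulA ea omulZl -omulA; apply: staircaseZ.
apply: closedXn; elim: n {ea} => [|n IH].
  by rewrite esymw0 -[1 ** _]/(opow (X i) 0 ** _); apply: low (hg k).
rewrite E'S; apply: staircaseB; last exact: closedX.
by rewrite -[esymw _ _ ** _]omul1l -[1 ** _]/(opow (X i) 0 ** _); apply: low => //; apply: IHE (hg k).
Qed.

Lemma staircase1 s : (size s <= l)%N -> staircase s 1.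
Proof.
elim: s => [|i s IH] hs; first exact: gen_1.
rewrite -[1]omul1l -[X in X ** _]/(opow (X i) 0); apply: staircase_pow; first by rewrite subn_gt0.
by apply: IH; apply: ltnW.
Qed.

Lemma staircase_full f : staircase (rev (enum 'I_l)) f.
Proof.
have e : catrev (rev (enum 'I_l)) [::] = enum 'I_l by rewrite catrevE revK cats0.
have [cX _] := staircase_closed e.
elim/letter_ind: f => [|p q|c p|i p].
- by apply: staircase1; rewrite size_rev size_enum_ord.
- exact: staircaseD.
- exact: staircaseZ.
by apply: cX; rewrite mem_rev mem_enum.
Qed.

(** The sum is the largest degree of the staircase monomials in the variables of [s]. Moving them
    into [p] one variable at a time keeps its degree at most [size w], so in the end [demw w] turns
    [p] into a scalar. *)
Lemma demw_staircase (w : seq nat) s n p f : valid_word l w -> hdeg n p ->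
  (n + \sum_(k < size s) (l - k.+1) <= size w)%N -> staircase s f ->
  OSym (demw w (p ** f)).
Proof.
move=> vw; elim: s n p f => [|i s IH] n p f hp.
  rewrite big_ord0 addn0 => nw hf; rewrite demwMr //; last exact: OSym_invariant.
  have := hdeg_demw vw hp; rewrite (eqP (_ : n - size w == 0)%N) ?subn_eq0 // => /hdeg0P->.
  by rewrite omulZl omul1l; apply: gen_scale.
rewrite /= big_ord_recr /= => nw [g hg ->]; rewrite omul_sumr demw_sum.
elim/big_ind: _ => [||k _]; first exact: (staircase0 [::]).
  exact: gen_add.
rewrite omulA; apply: (IH (n + k)%N) => //; last first.
  by apply: leq_trans nw; rewrite -addnA leq_add2l addnC leq_add2l; have := ltn_ord k; lia.
apply: hdegM => //; elim: (val k) => [|k' IHk].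
  exact: hdeg1.
exact: hdegM (@hdegU K l i) IHk.
Qed.

Lemma invariant_OSym (w : seq nat) p c f : valid_word l w -> size w = maxlen l ->
  c != 0 -> demw w p = c *: 1 -> invariant f -> OSym f.
Proof.
move=> vw sw nc ew hf; have -> : f = c^-1 *: demw w (1 ** (p ** f)).
  by rewrite omul1l demwMr // ew omulZl omul1l scalerA mulVf // scale1r.
apply: gen_scale; apply: (demw_staircase (n := 0)) (staircase_full _) => //.
  exact: hdeg1.
by rewrite size_rev size_enum_ord sw.
Qed.

End Invariants.

(** * Minimal coset representatives and the basis *)

Section Support.
Variables (K : fieldType) (l : nat).
Local Notation P := {mpoly K[l]}.
Local Notation X := (@X K l).
Implicit Types (a b d : 'X_{1..l}) (p q : P) (i k m : 'I_l) (s : seq nat) (j n : nat).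

Definition substair p := forall a, p@_a != 0 -> forall i, (a i <= l - i.+1)%N.

(** Both new exponents are strictly below the old maximum, hence at most [l - j.+2], the bound at
    the later position [k]. *)
Lemma substair_dem j p : (j.+1 < l)%N -> substair p -> substair (dem j p).
Proof.
move=> /ord_pair[i [k [ei ek _ _]]] hp d /dem_mcoeff[a /hp ha].
have [h _] := dem_mono K a ei ek => /h[oth di dk _] m.
have := ha i; have := ha k; rewrite ei ek => hk hi.
have [->|mi] := eqVneq m i; first by rewrite ei; lia.
have [->|mk] := eqVneq m k; first by rewrite ek; lia.
by rewrite oth.
Qed.

Lemma substair_demw s p : valid_word l s -> substair p -> substair (demw s p).
Proof.
move=> + hp; elim: s => //= j s IH /andP[hj /IH]; exact: substair_dem.
Qed.

Lemma substair_xi : substair (xi K l).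
Proof.
have [c _ ->] := xi_stair K l; move=> a; rewrite mcoeffZ mcoeffX.
by have [<- _ i|_] := eqVneq (stair l l) a; rewrite ?mulr0 ?eqxx // mnmE; lia.
Qed.

Definition free_from n p := forall a, p@_a != 0 -> forall i, (n <= i)%N -> a i = 0%N.

(** If [X i] occurs in a monomial [a] of [p], then [dem j] produces [a - U_(i)] from it. Another
    monomial of [p] producing the same would have exponent zero at [k], agree with [a] away from [i]
    and [k], and have the same degree, so it would be [a]. *)
Lemma free_from_dem j p : (j.+1 < l)%N -> dem j p = 0 -> free_from j.+1 p -> free_from j p.
Proof.
move=> /ord_pair[i [k [ei ek nki nik]]] dp hp a pa m.
rewrite leq_eqVlt => /orP[/eqP jm|]; last exact: hp.
have {m jm} -> : m = i by apply: val_inj; rewrite /= ei.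
have freek b : p@_b != 0 -> b k = 0%N by move=> pb; apply: (hp b pb); rewrite ek.
apply/eqP; rewrite -leqn0 leqNgt; apply/negP => ai.
have [_ /(_ _)] := dem_mono K a ei ek; rewrite (freek a pa) => /(_ ai) /negP; apply.
have := congr1 (mcoeff (a - U_(i))%MM) dp; rewrite mcoeff0.
rewrite -[p in dem j p](subrK (p@_a *: 'X_[a])) addrC demD demZ mcoeffD mcoeffZ.
set q := p - _; suff -> : (dem j q)@_(a - U_(i))%MM = 0.
  by rewrite addr0 => /eqP; rewrite mulf_eq0 (negPf pa).
apply/eqP; case: eqP => // /eqP/dem_mcoeff[b]; rewrite mcoeffB mcoeffZ mcoeffX.
have [<-|nab] := eqVneq a b; first by rewrite mulr1 subrr eqxx.
rewrite mulr0 subr0 => pb; have [h _] := dem_mono K b ei ek; case/h => oth _ _ deg.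
case/eqP: nab; have {}oth m : m != i -> m != k -> a m = b m.
  by move=> mi mk; rewrite -oth // mnmBE mnm1E eq_sym (negPf mi) subn0.
have aS : (mdeg (a - U_(i))%MM).+1 = mdeg a by rewrite {2}(mnm_subK ai) mdegD mdeg1.
move: deg; rewrite aS !(mdeg_pair _ nik) (freek a pa) (freek b pb).
rewrite (eq_bigr b) => [|m /andP[mi mk]]; last exact: oth.
move/addIn/addIn => eab; apply/mnmP => m; have [->//|mi] := eqVneq m i.
by have [->|mk] := eqVneq m k; [rewrite (freek a pa) (freek b pb)|apply: oth].
Qed.

Lemma free_from_OPol n p : free_from n p -> OPol n p.
Proof.
move=> hp; rewrite [p]mpolyE big_seq; elim/big_ind: _ => [||a].
- by rewrite -(scale0r 1); apply/gen_scale/gen_1.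
- exact: gen_add.
rewrite mcoeff_msupp => /hp ha; apply: gen_scale; rewrite -prodw_mword.
have : {in mword a, forall i, (i < n)%N}.
  move=> i /flatten_mapP[k _]; rewrite mem_nseq => /andP[ak /eqP->].
  by rewrite ltnNge; apply: contraL ak => /ha->.
elim: (mword a) => [|i w IH] hw /=; first exact: gen_1.
apply: gen_mul; last by apply: IH => k kw; apply: hw; rewrite inE kw orbT.
by apply: gen_in; exists i; rewrite hw ?mem_head.
Qed.

End Support.

(** * Descents and minimal coset representatives *)

Section MinCoset.
Variable l : nat.
Implicit Types (al : seq nat) (u w : 'S_l) (i k x y : 'I_l) (j : nat).

Lemma sj_Salpha al j : (j.+1 < l)%N -> j.+1 \notin psums al -> sj l j \in Salpha l al.
Proof.
move=> hj nj; apply: mem_gen; apply/imsetP; exists (Ordinal (ltnW hj)) => //.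
by rewrite inE /= hj.
Qed.

Lemma mincoset_asc al w j : (j.+1 < l)%N -> j.+1 \notin psums al -> mincoset al w ->
  (plen w < plen (w * sj l j)%g)%N.
Proof.
move=> hj nj /forall_inP/(_ _ (sj_Salpha hj nj)).
by case: (plen_sjr w hj); lia.
Qed.

(** Each generator preserves the initial segment below every partial sum. *)
Lemma Salpha_cut al u j : u \in Salpha l al -> j \in psums al ->
  forall x, (u x < j)%N = (x < j)%N.
Proof.
case/gen_prodgP => n [c hc ->] hj; elim/big_ind: _ => [x|v w hv hw x|i _ x].
- by rewrite perm1.
- by rewrite permM hw hv.
have /imsetP[m] := hc i; rewrite inE => /andP[hm nm] ->.
have [a [b [ea eb _ _]]] := ord_pair hm; rewrite (sjE ea eb).
have njm : j != m.+1 by apply: contraNneq nm => <-.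
by case: tpermP => [->|->|//]; rewrite ea eb; lia.
Qed.

(** Without such a descent [w^-1] increases on each block of values, so the two values of an
    inversion of [w] are separated by a partial sum. Elements of [Salpha l al] respect this
    separation, so every inversion of [w] is one of [w * u]. *)
Lemma not_mincoset_desc al w : ~~ mincoset al w ->
  exists j, [/\ (j.+1 < l)%N, j.+1 \notin psums al & (plen (w * sj l j)%g < plen w)%N].
Proof.
pose desc (j : 'I_l) :=
  [&& (j.+1 < l)%N, j.+1 \notin psums al & (plen (w * sj l j)%g < plen w)%N].
have [/existsP[j /and3P[h1 h2 h3]] _|nodesc /negP[]] := boolP [exists j, desc j].
  by exists j.
have asc n x y : (y = x + n :> nat)%N -> (0 < n)%N ->
    (forall j, (x < j <= y)%N -> j \notin psums al) -> (w^-1%g x < w^-1%g y)%N.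
  elim: n x => // n IH x eyx _ cut.
  have hx : (x.+1 < l)%N by have := ltn_ord y; lia.
  have [a [b [ea eb _ nab]]] := ord_pair hx.
  have exa : x = a by apply: val_inj.
  have lt : (w^-1%g x < w^-1%g b)%N.
    move: nodesc; rewrite negb_exists => /forallP/(_ x); rewrite /desc hx.
    rewrite cut /=; last lia.
    rewrite -plenV invMg sjV -[plen w]plenV (plen_lt_desc _ ea eb) exa.
    by rewrite perm_neq_ltn // negbK.
  case: n IH eyx => [_|n IH] eyx.
    by have -> : y = b by apply: val_inj; rewrite /= eb eyx addn1.
  apply: ltn_trans lt (IH b _ _ _) => //; first by rewrite eb eyx; lia.
  by move=> j hj; apply: cut; lia.
apply/forall_inP => u hu; apply: subset_leq_card; apply/subsetP => -[a b].
rewrite !inE /= => /andP[lab wba]; rewrite lab !permM /=.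
have [/hasP[j hj /andP[h1 h2]]|/hasPn ncut] :=
    boolP (has (fun j => (w b < j)%N && (j <= w a)%N) (psums al)).
  have := Salpha_cut hu hj (w b); have := Salpha_cut hu hj (w a); lia.
have : (w^-1%g (w b) < w^-1%g (w a))%N.
  apply: (asc (w a - w b)%N); rewrite ?subn_gt0 // ?subnKC 1?ltnW //.
  by move=> j hj; apply: contraL hj => /ncut.
by rewrite !permK ltnNge ltnW.
Qed.

(** A partial sum is either the total [l] or omits the last part, and is then at most
    [l - last 0%N al]. *)
Lemma psums_last al j : sumn al = l -> (1 <= size al)%N -> (l - last 0%N al <= j)%N ->
  (j.+1 < l)%N -> j.+1 \notin psums al.
Proof.
case/lastP: al => // al x; rewrite sumn_rcons last_rcons => el _ hj hjl.
apply/mapP => -[k]; rewrite mem_iota size_rcons /= add0n ltnS => hk e.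
have sumE n s : (n <= size s)%N -> \sum_(i < n) nth 0%N s i = sumn (take n s).
  elim: n => [|n IH] hn; first by rewrite big_ord0 take0.
  by rewrite big_ord_recr /= IH 1?ltnW // (take_nth 0%N) // sumn_rcons.
move: e; rewrite sumE ?size_rcons ?ltnS //; move: hk; rewrite leq_eqVlt => /orP[/eqP->|hk].
  by rewrite take_oversize ?size_rcons // sumn_rcons; lia.
rewrite -cats1 takel_cat //; have := congr1 sumn (cat_take_drop k.+1 al).
by rewrite sumn_cat; lia.
Qed.

End MinCoset.

(** * The odd Schubert basis over the common kernel *)

Section Basis.
Variables (K : fieldType) (l : nat) (al : seq nat) (red : 'S_l -> seq nat).
Hypothesis hred : forall w, reduced_word w (red w).
Local Notation P := {mpoly K[l]}.
Local Notation demw := (@demw K l).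
Local Notation pw := (oschub K red).
Implicit Types (f g p q : P) (u v w : 'S_l) (s : seq nat) (j n : nat).

Lemma OSymA_mul f g : OSymA al f -> invariant g -> OSymA al (f ** g).
Proof. by move=> hf hg j hj nj; rewrite demM // hf // hg // omul0l omul0r addr0. Qed.

Lemma oschub_OSymA w : mincoset al w -> OSymA al (pw w).
Proof. by move=> mw j hj nj; apply: (dem_oschub_asc K hred hj); apply: mincoset_asc nj mw. Qed.

Lemma oschub_OPol w : sumn al = l -> (1 <= size al)%N -> mincoset al w ->
  OPol (l - last 0%N al) (pw w).
Proof.
move=> hsum hk mw; apply: free_from_OPol.
have fl : free_from l.-1 (pw w).
  have [vr _] := hred (w^-1 * wlong l)%g.
  move=> a pa i hi; have := substair_demw vr (@substair_xi K l) pa i.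
  by have := ltn_ord i; lia.
have [lt|ge] := ltnP l.-1 (l - last 0%N al).
  by move=> a pa i hi; apply: (fl a pa); lia.
have gen n : (n <= l.-1 - (l - last 0%N al))%N -> free_from (l.-1 - n) (pw w).
  elim: n => [|n IH] hn; first by rewrite subn0.
  have hj : ((l.-1 - n.+1).+1 < l)%N by lia.
  apply: free_from_dem => //.
    by apply: oschub_OSymA => //; apply: psums_last => //; lia.
  by rewrite (_ : (l.-1 - n.+1).+1 = l.-1 - n)%N; [apply: IH|]; lia.
by have := gen _ (leqnn _); rewrite subKn.
Qed.

(** Induction on the length of the words that kill [f]: subtracting multiples of the [pw w] with [w]
    minimal of length [n] leaves an element already killed by words of length [n]. An element killed
    by the empty word is zero. *)
Lemma demw_oschub_span n f : OSymA al f ->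
  (forall s, valid_word l s -> size s = n -> demw s f = 0) ->
  exists2 c : 'S_l -> P, forall w, invariant (c w) &
    f = \sum_(w : 'S_l | mincoset al w) pw w ** c w.
Proof.
elim: n f => [|n IH] f hf kill.
  exists (fun=> 0) => [w j hj|]; first exact: dem0.
  rewrite big1 => [|w _]; last exact: omul0r.
  exact: (kill [::]).
pose kap w := (demw (red w) (pw w))@_0%MM.
have kapE w : demw (red w) (pw w) = kap w *: 1.
  by rewrite /kap; have [d _ ->] := demw_oschub K hred w; rewrite mcoeffZ mcoeff1 eqxx mulr1.
have kap0 w : kap w != 0.
  by rewrite /kap; have [d nd ->] := demw_oschub K hred w; rewrite mcoeffZ mcoeff1 eqxx mulr1.
(* Chosen so that [demw (red w)] kills the difference [f'] for minimal [w] of length [n]. The value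
   is invariant because one more [dem j] makes a word of length [n.+1], which kills [f]. *)
pose cw w := if plen w == n then (kap w)^-1 *: demw (red w) f else 0.
have cwI w : invariant (cw w).
  move=> j hj; rewrite /cw; case: eqP => [ew|_]; last exact: dem0.
  have [vr [_ sr]] := hred w; rewrite demZ.
  have -> : dem j (demw (red w) f) = demw (j :: red w) f by [].
  by rewrite kill ?scaler0 //= ?hj // sr ew.
pose f' := f - \sum_(w : 'S_l | mincoset al w) pw w ** cw w.
have hf' : OSymA al f'.
  move=> j hj nj; rewrite /f' -scaleN1r demD demZ hf // add0r.
  rewrite (big_morph _ (@demD K l j) (dem0 K l j)) big1 ?scaler0 // => w mw.
  exact: (OSymA_mul (oschub_OSymA mw) (cwI w)).
have [s vs sn|c hc ec] := IH f' hf'; last first.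
  exists (fun w => c w + cw w) => [w j hj|]; first by rewrite demD hc // cwI // addr0.
  under eq_bigr do rewrite omulDr.
  by rewrite big_split /= -ec /f' subrK.
have [rs|nrs] := eqVneq (size s) (plen (wprod l s)); last exact: (demw_nonreduced hred).
set w := wprod l s in rs; have [vr [er sr]] := hred w.
have [d nd ed] := reduced_demw_eq K hred vs vr (esym er) rs (etrans sr (congr1 _ (esym er))).
have other v : v != w -> demw s (pw v ** cw v) = 0.
  move=> nvw; rewrite demwMr //; rewrite /cw; case: eqP => [ev|_]; last exact: omul0r.
  have [->|nz] := eqVneq (demw s (pw v)) 0; first exact: omul0l.
  case/eqP: nvw; rewrite -(demw_oschub_neq0 hred vs _ nz) //.
  by rewrite ev sn.
rewrite /f' demwB demw_sum; have [mw|nmw] := boolP (mincoset al w).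
  rewrite (bigD1 w) //= big1 ?addr0 => [|v /andP[_ /other//]].
  rewrite demwMr // !ed kapE scalerA omulZl omul1l /cw -rs sn eqxx scalerA.
  by rewrite mulfK // subrr.
(* For non-minimal [w] no term corrects [f]. Instead, a reduced word of [w] ends with some [j] for
   which [j.+1] is not a partial sum, and [dem j], applied first, kills [f]. *)
rewrite big1 ?subr0 => [|v mv]; last by apply: other; apply: contraNneq nmw => <-.
have [j [hj nj desc]] := not_mincoset_desc nmw.
have [vj [ej sj']] := hred (w * sj l j)%g.
have v' : valid_word l (rcons (red (w * sj l j)%g) j).
  by rewrite /valid_word all_rcons hj.
have e' : wprod l (rcons (red (w * sj l j)%g) j) = w.
  by rewrite -cats1 wprod_cat ej /wprod big_seq1 -mulgA sjK mulg1.
have s' : size (rcons (red (w * sj l j)%g) j) = plen w.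
  by rewrite size_rcons sj'; case: (plen_sjr w hj); lia.
have [d' _ ->] := reduced_demw_eq K hred vs v' (esym e') rs (etrans s' (congr1 _ (esym e'))).
by rewrite -cats1 demw_cat /= hf // demw0 scaler0.
Qed.

Lemma invariantP f : invariant f <-> OSym f.
Proof.
split; last exact: OSym_invariant.
have [vr [_ sr]] := hred (wlong l); have [c nc e] := demw_wlong K hred.
by apply: (invariant_OSym vr _ nc e); rewrite sr plen_wlong1.
Qed.

Lemma oschub_span f : OSymA al f ->
  exists c : 'S_l -> P, (forall w, mincoset al w -> OSym (c w)) /\
    f = \sum_(w : 'S_l | mincoset al w) pw w ** c w.
Proof.
move=> hf; have [|c hc ->] := @demw_oschub_span (maxlen l).+1 f hf.
  move=> s vs sN; apply: (demw_nonreduced hred) => //.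
  by have := plen_le (wprod l s); rewrite sN; lia.
by exists c; split=> // w _; apply/invariantP.
Qed.

(** Longest permutations first: [demw (red w)] kills the terms of the other permutations no longer
    than [w] by triangularity, and the coefficients at longer ones are zero by induction. *)
Lemma oschub_free (Q : pred 'S_l) (c : 'S_l -> P) : (forall w, Q w -> invariant (c w)) ->
  \sum_(w | Q w) pw w ** c w = 0 -> forall w, Q w -> c w = 0.
Proof.
move=> hc e w; have [n] := ubnP (maxlen l - plen w)%N; elim: n w => // n IH w lt Qw.
have [vr [er sr]] := hred w; have := congr1 (demw (red w)) e; rewrite demw0 demw_sum.
rewrite (bigD1 w) //= big1 ?addr0 => [|v /andP[Qv nvw]].
  have [d nd ed] := demw_oschub K hred w; rewrite demwMr ?hc // ?ed; last exact: hc.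
  rewrite omulZl omul1l => /eqP; rewrite scaler_eq0 (negPf nd) /=; exact: eqP.
have [le|gt] := leqP (plen v) (plen w).
  rewrite demwMr //; last exact: hc.
  have [->|nz] := eqVneq (demw (red w) (pw v)) 0; first exact: omul0l.
  by case/eqP: nvw; rewrite -er (demw_oschub_neq0 hred vr _ nz) // sr.
rewrite (IH v) // ?omul0r ?demw0 //; have := plen_le v; lia.
Qed.

End Basis.

Theorem mainTheorem15 (K : fieldType) (hK : (2%:R : K) != 0)
  (l : nat) (hl : (1 <= l)%N) (al : seq nat)
  (hpos : all (fun a => 0 < a)%N al) (hsum : sumn al = l)
  (hk : (1 <= size al)%N)
  (red : 'S_l -> seq nat) (hred : forall w, reduced_word w (red w)) :
  (* OSym_alpha is a right OSym_l-module *)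
  (forall f g : {mpoly K[l]}, OSymA al f -> OSym g -> OSymA al (omul f g)) /\
  (* basis elements: homogeneous, in OSym_alpha and in OPol_{l - alpha_k} *)
  (forall w, mincoset al w ->
     [/\ homogeneous (oschub K red w), OSymA al (oschub K red w)
       & OPol (l - last 0%N al) (oschub K red w)]) /\
  (* spanning *)
  (forall f, OSymA al f ->
     exists c : 'S_l -> {mpoly K[l]},
       (forall w, mincoset al w -> OSym (c w)) /\
       f = \sum_(w : 'S_l | mincoset al w) omul (oschub K red w) (c w)) /\
  (* linear independence over OSym_l *)
  (forall c c' : 'S_l -> {mpoly K[l]},
     (forall w, mincoset al w -> OSym (c w) /\ OSym (c' w)) ->
     \sum_(w : 'S_l | mincoset al w) omul (oschub K red w) (c w) =
     \sum_(w : 'S_l | mincoset al w) omul (oschub K red w) (c' w) ->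
     forall w, mincoset al w -> c w = c' w).
Proof.
split; first by move=> f g hf /OSym_invariant; apply: OSymA_mul.
split.
  move=> w mw; split; [|exact: oschub_OSymA|exact: oschub_OPol].
  by exists (odd (plen w)) => a; rewrite mcoeff_msupp => /(hdeg_oschub hred) ->.
split; first exact: oschub_span.
move=> c c' hc e w mw; apply/eqP; rewrite -subr_eq0; apply/eqP.
apply: (oschub_free hred (Q := mincoset al) (c := fun w => c w - c' w)) => // [v /hc[h h'] j hj|].
  by rewrite demD demN !(OSym_invariant _ hj) ?subrr.
under eq_bigr do rewrite omulBr.
by rewrite sumrB e subrr.
Qed.
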